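(* Let $\phi\in[0,\pi)$. For $T>0$ let $N_\phi^\Delta(T)$ denote the number of real roots $t\in(0,T]$, counted with multiplicity, of the equation $\Delta(\tfrac12+it)=e^{2i\phi}$. Then, as $T\to\infty$, $$N_\phi^\Delta(T)=\frac{T}{2\pi}\log\frac{T}{2\pi e}+O(\log T).$$ In particular, the set $\{\zeta(\tfrac12+it): t\in\mathbb{R}\}\cap e^{i\phi}\mathbb{R}$ is countable.
   Context: $\zeta(s)$ is the Riemann zeta-function. $\Delta(s):=2^s\pi^{s-1}\Gamma(1-s)\sin(\pi s/2)$ is the factor in the functional equation $\zeta(s)=\Delta(s)\zeta(1-s)$; it satisfies $\Delta(s)\Delta(1-s)=1$, so $|\Delta(\tfrac12+it)|=1$ for real $t$. $e^{i\phi}\mathbb{R}=\{e^{i\phi}x: x\in\mathbb{R}\}$ is the straight line through the origin in direction $e^{i\phi}$. The parameter $\phi$ is fixed as $T\to\infty$. *)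

(* Defs.v *)
From Stdlib Require Import Reals Factorial Lra Lia List Permutation Classical.
From Coquelicot Require Import Coquelicot.
Local Open Scope C_scope.

Definition Cexp (z : C) : C :=
  ((exp (Re z) * cos (Im z))%R, (exp (Re z) * sin (Im z))%R).

Definition Csin (z : C) : C :=
  (Cexp (Ci * z) - Cexp (- (Ci * z))) / (2 * Ci).

(* x ^ s for a real base x > 0 *)
Definition Rcpow (x : R) (s : C) : C := Cexp (s * ln x).

Definition Clim_seq (u : nat -> C) : C :=
  (real (Lim_seq (fun n => Re (u n))), real (Lim_seq (fun n => Im (u n)))).

(* z (z + 1) ... (z + n - 1) *)
Fixpoint rising (z : C) (n : nat) : C :=
  match n with
  | O => 1
  | S m => rising z m * (z + INR m)
  end.

(* Euler's limit n! n^z / (z (z + 1) ... (z + n)), which defines Gamma on the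
   whole plane minus the poles 0, -1, -2, ...; the values at the poles are
   junk. *)
Definition CGamma (z : C) : C :=
  Clim_seq (fun n => INR (fact n) * Rcpow (INR n) z / rising z (S n)).

(* The factor in zeta(s) = zDelta(s) zeta(1 - s). *)
Definition zDelta (s : C) : C :=
  Rcpow 2 s * Rcpow PI (s - 1) * CGamma (1 - s) * Csin (PI * s / 2).

Definition analytic_at (f : C -> C) (z0 : C) : Prop :=
  exists a : nat -> C,
    locally z0 (fun z =>
      @is_pseries C_AbsRing C_NormedModule a (z - z0) (f z)).

(* The Riemann zeta function as the analytic continuation of its Dirichlet
   series to C \ {1}.  The value at 1 is left unspecified. *)
Definition is_riemann_zeta (zeta : C -> C) : Prop :=
  (forall s : C, s <> 1 -> analytic_at zeta s) /\
  (forall s : C, (1 < Re s)%R ->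
     @is_series C_AbsRing C_NormedModule
       (fun n : nat => Rcpow (INR (S n)) (- s)) (zeta s)).

(* t0 is a zero of F of multiplicity exactly m; m = 0 means F t0 <> 0. *)
Definition zero_of_order (F : R -> C) (t0 : R) (m : nat) : Prop :=
  exists g : R -> C,
    continuous g t0 /\ g t0 <> 0 /\
    locally t0 (fun t => F t = RtoC (t - t0) ^ m * g t).

Lemma zero_of_order_le (F : R -> C) (t0 : R) (m n : nat) :
  zero_of_order F t0 m -> zero_of_order F t0 n -> (n <= m)%nat.
Proof.
intros [g [gc [g0 gF]]] [h [hc [_ hF]]].
destruct (Compare_dec.le_lt_dec n m) as [|lt]; [assumption|exfalso].
destruct (Nat.lt_exists_pred 0 (n - m)) as [k [Ek _]]; [lia|].
apply g0.
assert (Hle : filter_le (locally' t0) (locally t0)).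
{ intros P [e He]; exists e; intros y Hy _; now apply He. }
assert (Hg : filterlim g (locally' t0) (locally (g t0))).
{ exact (filterlim_filter_le_1 _ Hle gc). }
pose (p := fun t : R => RtoC ((t - t0) ^ S k) * h t).
assert (Hp : filterlim p (locally' t0) (locally (p t0))).
{ apply (filterlim_filter_le_1 _ Hle).
  apply (continuous_ext
    (fun t : R => @scal _ C_R_NormedModule ((t - t0) ^ S k)%R (h t))).
  { intros t; unfold p; now rewrite scal_R_Cmult. }
  apply (@continuous_scal R_UniformSpace R_AbsRing C_R_NormedModule);
    [|exact hc].
  apply (ex_derive_continuous (fun t : R => (t - t0) ^ S k)%R).
  auto_derive; trivial. }
assert (Hpg : filterlim p (locally' t0) (locally (g t0))).
{ refine (filterlim_ext_loc _ _ _ Hg).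
  destruct (filter_and _ _ gF hF) as [e He].
  exists e; intros t Ht nt.
  destruct (He t Ht) as [E1 E2].
  rewrite E1 in E2.
  replace n with (m + S k)%nat in E2 by lia.
  rewrite Cpow_add_r, <- Cmult_assoc in E2.
  unfold p; rewrite RtoC_pow.
  assert (nz : RtoC (t - t0) ^ m <> 0).
  { apply Cpow_nz; intros E; apply RtoC_inj in E; apply nt; lra. }
  apply (f_equal (Cmult (/ (RtoC (t - t0) ^ m)))) in E2.
  rewrite !Cmult_assoc, !Cinv_l, !Cmult_1_l in E2 by exact nz.
  exact E2. }
rewrite (@filterlim_locally_unique R R_AbsRing C_R_NormedModule _
  (Proper_StrongProper _ (Rbar_locally'_filter (Finite t0))) _ _ _ Hpg Hp).
unfold p; rewrite Rminus_diag.
simpl; rewrite Rmult_0_l; apply Cmult_0_l.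
Qed.

(* l lists the zeros of F in (0, T], each repeated according to its
   multiplicity. *)
Definition lists_zeros (F : R -> C) (T : R) (l : list R) : Prop :=
  (forall t : R, In t l -> (0 < t <= T)%R) /\
  (forall t : R, (0 < t <= T)%R ->
     zero_of_order F t (count_occ Req_dec_T l t)).

Definition number_of_zeros (F : R -> C) (T : R) (n : nat) : Prop :=
  exists l : list R, lists_zeros F T l /\ length l = n.

Lemma number_of_zeros_unique (F : R -> C) (T : R) (m n : nat) :
  number_of_zeros F T m -> number_of_zeros F T n -> m = n.
Proof.
intros [l [[l1 l2] <-]] [l' [[l1' l2'] <-]].
apply Permutation_length, (Permutation_count_occ Req_dec_T).
intros t.
destruct (classic (0 < t <= T)%R) as [ht|ht].
- apply Nat.le_antisymm; eapply zero_of_order_le; eauto.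
- rewrite !(proj1 (count_occ_not_In _ _ _)); auto.
Qed.

Definition line (phi : R) (w : C) : Prop :=
  exists x : R, w = Cexp (Ci * phi) * x.

Definition countable_set (A : C -> Prop) : Prop :=
  exists f : C -> nat, forall z w : C, A z -> A w -> f z = f w -> z = w.

(* Main.v *)
Require Import Defs.
From Stdlib Require Import Reals.
From Stdlib Require Import Factorial ZArith Lra Lia List Classical ClassicalEpsilon.
From Stdlib Require Cantor.
From Coquelicot Require Import Coquelicot.
Import ListNotations.
Local Open Scope R_scope.

(** On the critical line the factor of the functional equation is a pure phase:
    [zDelta (1/2 + i t) = e^(i theta t)] with
    [theta t = t ln (2 pi) + arg Gamma (1/2 - i t) + atan (e^(pi t)) - pi/4],
    the last two terms being the argument of [sin (pi s / 2)] ([zDelta_half]).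

    The modulus is 1 because [|Gamma (1/2 - i t)|^2 = pi / cosh (pi t)].  In Euler's
    limit this says that [n (n!)^2 / prod_(k <= n) ((k + 1/2)^2 + t^2)] tends to
    [pi / cosh (pi t)].  As in Euler's proof of the sine product, the finite products
    are evaluated by the integrals of [cosh (a x) cos^n x] over [0, pi/2], which obey
    a two-step recurrence in [n] ([wallis_rec], [gamma_half_sq_wallis]); for large [n] the
    mass sits at [x = 0], the parameter [a] becomes irrelevant, and Wallis's formula
    gives the limit ([gamma_half_sq_lim]).

    The argument of Gamma is the limit of [sum_(k <= n) atan (t / (k + 1/2)) - t ln n].
    Two facts about it drive the count of roots.
    - The second derivative is a sum of terms of the sign of [- t], so [theta] is strictly
      concave on [t > 0] ([theta2_neg]): it has at most one critical point.
    - The summands decrease in [k], so the sum is the integral of [atan (t / x)] up to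
      a bounded error, and [theta T = - T ln (T / (2 pi e)) + O(1)] ([theta_asymptotic]).
    A root is a point where [theta] meets one of the levels [2 phi + 2 pi k].  Its order is
    1 where [theta' <> 0] and 2 at the critical point, so the roots in [(0, T]] form
    a finite list with multiplicities ([number_of_zeros_exists]).  Beyond a fixed [t0] the
    phase decreases, each level between [theta T] and [theta t0] is met exactly once,
    and there are [(theta t0 - theta T) / (2 pi) + O(1)] of them ([number_of_zeros_tail]).

    The countability of the values of zeta on the line does not go through the
    functional equation.  With [e = e^(- i phi)], the function
    [e zeta s - conj (e zeta (1 - conj s))] is analytic off 0 and 1, and on the critical
    line it vanishes exactly where [zeta s] lies on the line of direction [e^(i phi)].
    If these zeros accumulated, the function would vanish identically, hence
    [|zeta sigma| = |zeta (1 - sigma)|] for real [sigma > 1]; but the left side is unbounded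
    as [sigma] tends to 1 and the right side is not ([critical_zeros_isolated]).
    So the zeros are isolated, and a set of isolated reals is countable. *)

(** * Wallis integrals with a hyperbolic weight *)

Definition wallis (a : R) (n : nat) : R :=
  RInt (fun x => cosh (a * x) * cos x ^ n) 0 (PI / 2).

Lemma wallis_integrand_continuous (a : R) (n : nat) (x : R) :
  continuous (fun x => cosh (a * x) * cos x ^ n) x.
Proof.
apply (ex_derive_continuous (fun x => cosh (a * x) * cos x ^ n)).
unfold cosh; auto_derive; trivial.
Qed.

Lemma wallis_correct (a : R) (n : nat) :
  is_RInt (fun x => cosh (a * x) * cos x ^ n) 0 (PI / 2) (wallis a n).
Proof.
apply (@RInt_correct R_CompleteNormedModule), (@ex_RInt_continuous R_CompleteNormedModule).
intros x _; apply wallis_integrand_continuous.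
Qed.

(** Integration by parts, twice: the integrand of the difference of the two sides is the
    derivative of [cos^(n+2) x a sinh (a x) + (n + 2) cos^(n+1) x sin x cosh (a x)],
    which vanishes at 0 and at [pi/2]. *)
Lemma wallis_rec (a : R) (n : nat) :
  (a ^ 2 + INR (n + 2) ^ 2) * wallis a (n + 2) = INR (n + 2) * INR (n + 1) * wallis a n.
Proof.
pose (F := fun x => cos x ^ (n + 2) * (a * sinh (a * x))
                    + INR (n + 2) * (cos x ^ (n + 1) * sin x * cosh (a * x))).
pose (f := fun x => (a ^ 2 + INR (n + 2) ^ 2) * (cosh (a * x) * cos x ^ (n + 2))
                    - INR (n + 2) * INR (n + 1) * (cosh (a * x) * cos x ^ n)).
assert (H1 : is_RInt f 0 (PI / 2) (minus (F (PI / 2)) (F 0))).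
{ apply (@is_RInt_derive R_CompleteNormedModule).
  - intros x _; unfold F, f.
    evar_last.
    { unfold cosh, sinh; auto_derive; [trivial|reflexivity]. }
    unfold cosh.
    replace (Init.Nat.pred (n + 2)) with (n + 1)%nat by lia.
    replace (Init.Nat.pred (n + 1)) with n by lia.
    rewrite !pow_add, !plus_INR.
    assert (E : sin x * sin x = 1 - cos x * cos x).
    { generalize (sin2_cos2 x); unfold Rsqr; lra. }
    simpl.
    ring_simplify. replace (sin x ^ 2) with (1 - cos x ^2) by (simpl; lra).
    field.
  - intros x _.
    apply (ex_derive_continuous f).
    unfold f, cosh; auto_derive; trivial. }
assert (E0 : minus (F (PI / 2)) (F 0) = 0).
{ unfold F, minus, plus, opp; simpl.
  rewrite cos_PI2, sin_0, !pow_i by lia.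
  rewrite Rmult_0_r, sinh_0; ring. }
rewrite E0 in H1.
assert (H2 : is_RInt f 0 (PI / 2)
  ((a ^ 2 + INR (n + 2) ^ 2) * wallis a (n + 2) - INR (n + 2) * INR (n + 1) * wallis a n)).
{ apply (@is_RInt_minus R_NormedModule); apply (@is_RInt_scal R_NormedModule);
    apply wallis_correct. }
generalize (is_RInt_unique _ _ _ _ H1) (is_RInt_unique _ _ _ _ H2); lra.
Qed.

Lemma wallis_1 (a : R) : (a ^ 2 + 1) * wallis a 1 = cosh (a * (PI / 2)).
Proof.
pose (F := fun x => cos x * (a * sinh (a * x)) + sin x * cosh (a * x)).
pose (f := fun x => (a ^ 2 + 1) * (cosh (a * x) * cos x ^ 1)).
assert (H1 : is_RInt f 0 (PI / 2) (minus (F (PI / 2)) (F 0))).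
{ apply (@is_RInt_derive R_CompleteNormedModule).
  - intros x _; unfold F, f.
    evar_last.
    { unfold cosh, sinh; auto_derive; [trivial|reflexivity]. }
    unfold cosh, sinh; field.
  - intros x _.
    apply (ex_derive_continuous f).
    unfold f, cosh; auto_derive; trivial. }
assert (E0 : minus (F (PI / 2)) (F 0) = cosh (a * (PI / 2))).
{ unfold F, minus, plus, opp; simpl.
  rewrite cos_PI2, sin_PI2, sin_0, Rmult_0_r, sinh_0; ring. }
rewrite E0 in H1.
rewrite <- (is_RInt_unique _ _ _ _ H1).
symmetry; apply is_RInt_unique, (@is_RInt_scal R_NormedModule), wallis_correct.
Qed.

Lemma wallis_0_0 : wallis 0 0 = PI / 2.
Proof.
unfold wallis; rewrite (RInt_ext _ (fun _ => 1)).
- rewrite RInt_const; unfold scal; simpl; unfold mult; simpl; ring.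
- intros x _; simpl; rewrite Rmult_0_l, cosh_0; ring.
Qed.

Lemma wallis_0_1 : wallis 0 1 = 1.
Proof. generalize (wallis_1 0); rewrite Rmult_0_l, cosh_0; lra. Qed.

Lemma wallis_0_rec (n : nat) : INR (n + 2) * wallis 0 (n + 2) = INR (n + 1) * wallis 0 n.
Proof.
assert (0 < INR (n + 2)) by (apply lt_0_INR; lia).
generalize (wallis_rec 0 n); intros E.
apply (Rmult_eq_reg_l (INR (n + 2))); [|lra]. lra.
Qed.

(** By the recurrence, the left side does not depend on [n]. *)
Lemma wallis_0_prod (n : nat) : INR (n + 1) * (wallis 0 n * wallis 0 (n + 1)) = PI / 2.
Proof.
induction n as [|n IH].
- simpl; rewrite wallis_0_0, wallis_0_1; ring.
- rewrite <- IH.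
  replace (S n + 1)%nat with (n + 2)%nat by lia.
  replace (S n) with (n + 1)%nat by lia.
  generalize (wallis_0_rec n). intros E.
  transitivity (wallis 0 (n + 1) * (INR (n + 2) * wallis 0 (n + 2))); [ring|].
  rewrite E; ring.
Qed.

Lemma wallis_0_pos (n : nat) : 0 < wallis 0 n.
Proof.
assert (H : 0 < wallis 0 n /\ 0 < wallis 0 (n + 1)); [|apply H].
induction n as [|n [IH1 IH2]].
- simpl; rewrite wallis_0_0, wallis_0_1; generalize PI_RGT_0; lra.
- replace (S n + 1)%nat with (n + 2)%nat by lia.
  replace (S n) with (n + 1)%nat by lia.
  split; [exact IH2|].
  assert (0 < INR (n + 2)) by (apply lt_0_INR; lia).
  assert (0 < INR (n + 1)) by (apply lt_0_INR; lia).
  generalize (wallis_0_rec n); intros E.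
  apply (Rmult_lt_reg_l (INR (n + 2))); [easy|].
  rewrite E, Rmult_0_r; now apply Rmult_lt_0_compat.
Qed.

Lemma wallis_0_decr (n : nat) : wallis 0 (n + 1) <= wallis 0 n.
Proof.
generalize PI_RGT_0; intros hp.
apply (is_RInt_le (fun x => cosh (0 * x) * cos x ^ (n + 1)) (fun x => cosh (0 * x) * cos x ^ n) 0
  (PI / 2));
  [lra|apply wallis_correct|apply wallis_correct|].
intros x [h1 h2].
rewrite Rmult_0_l, cosh_0, pow_add.
assert (0 <= cos x) by (apply cos_ge_0; lra).
generalize (COS_bound x) (pow_le (cos x) n H); intros.
simpl; nra.
Qed.

Lemma cosh_ge_1 (y : R) : 1 <= cosh y.
Proof.
unfold cosh.
assert (E : exp y * exp (- y) = 1) by (rewrite <- exp_plus, Rplus_opp_r; apply exp_0).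
generalize (exp_pos y) (exp_pos (- y)) (pow2_ge_0 (exp y - exp (- y))); intros.
assert (~ (exp y + exp (- y) < 2)) by nra.
lra.
Qed.

Lemma cosh_le (x y : R) : 0 <= x <= y -> cosh x <= cosh y.
Proof.
intros [h1 h2].
destruct (Rle_lt_or_eq_dec x y h2) as [h|<-]; [|lra].
destruct (MVT_gen cosh x y sinh) as [c [Hc E]].
- intros z _; unfold cosh, sinh; auto_derive; [trivial|field].
- intros z _. apply derivable_continuous_pt, derivable_pt_cosh.
- rewrite Rmin_left, Rmax_right in Hc by lra.
  assert (0 <= sinh c).
  { unfold sinh.
    assert (exp (- c) <= exp c).
    { destruct (Req_dec c 0) as [->|]; [rewrite Ropp_0; lra|].
      left; apply exp_increasing; lra. }
    lra. }
  nra.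
Qed.

Lemma sinh_le (y : R) : 0 <= y -> sinh y <= y * cosh y.
Proof.
intros h1.
destruct (Rle_lt_or_eq_dec 0 y h1) as [h|<-]; [|rewrite sinh_0; lra].
destruct (MVT_gen sinh 0 y cosh) as [c [Hc E]].
- intros z _; unfold cosh, sinh; auto_derive; [trivial|field].
- intros z _. apply derivable_continuous_pt, derivable_pt_sinh.
- rewrite Rmin_left, Rmax_right in Hc by lra.
  rewrite sinh_0 in E.
  generalize (cosh_le c y Hc); nra.
Qed.

Lemma cosh_sub_1_le (y : R) : 0 <= y -> cosh y - 1 <= y ^ 2 * cosh y.
Proof.
intros h1.
destruct (Rle_lt_or_eq_dec 0 y h1) as [h|<-]; [|rewrite cosh_0; lra].
destruct (MVT_gen cosh 0 y sinh) as [c [Hc E]].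
- intros z _; unfold cosh, sinh; auto_derive; [trivial|field].
- intros z _. apply derivable_continuous_pt, derivable_pt_cosh.
- rewrite Rmin_left, Rmax_right in Hc by lra.
  rewrite cosh_0 in E.
  generalize (cosh_le c y Hc) (sinh_le c (proj1 Hc)) (cosh_ge_1 c); intros.
  assert (sinh c <= y * cosh y) by nra. nra.
Qed.

Lemma mul_cos_le_sin (x : R) : 0 <= x <= PI / 2 -> x * cos x <= sin x.
Proof.
intros [h1 h2].
destruct (Rle_lt_or_eq_dec 0 x h1) as [h|<-]; [|rewrite sin_0; lra].
destruct (MVT_gen sin 0 x cos) as [c [Hc E]].
- intros z _; auto_derive; [trivial|ring].
- intros z _. apply derivable_continuous_pt, derivable_pt_sin.
- rewrite Rmin_left, Rmax_right in Hc by lra.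
  rewrite sin_0 in E.
  assert (cos x <= cos c); [|nra].
  destruct (Req_dec c x) as [->|]; [lra|].
  left; apply cos_decreasing_1; lra.
Qed.

Lemma wallis_ge (a : R) (n : nat) : wallis 0 n <= wallis a n.
Proof.
generalize PI_RGT_0; intros hp.
apply (is_RInt_le (fun x => cosh (0 * x) * cos x ^ n) (fun x => cosh (a * x) * cos x ^ n) 0 (PI /
  2));
  [lra|apply wallis_correct|apply wallis_correct|].
intros x [h1 h2].
rewrite Rmult_0_l, cosh_0.
assert (0 <= cos x) by (apply cos_ge_0; lra).
generalize (cosh_ge_1 (a * x)) (pow_le (cos x) n H); intros; nra.
Qed.

(** The weight costs little when [n] is large: [cosh (a x) - 1 <= C x^2], and
    [x cos x <= sin x] trades [x^2 cos^(n+2) x] for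
    [sin^2 x cos^n x = cos^n x - cos^(n+2) x], whose integral is a difference of
    consecutive Wallis integrals. *)
Lemma wallis_le (a : R) (n : nat) : 0 <= a ->
  wallis a (n + 2) <= wallis 0 (n + 2) + a ^ 2 * cosh (a * (PI / 2)) * (wallis 0 n - wallis 0 (n +
    2)).
Proof.
intros ha.
generalize PI_RGT_0; intros hp.
set (C := a ^ 2 * cosh (a * (PI / 2))).
apply (is_RInt_le (fun x => cosh (a * x) * cos x ^ (n + 2))
  (fun x => cosh (0 * x) * cos x ^ (n + 2)
    + C * (cosh (0 * x) * cos x ^ n - cosh (0 * x) * cos x ^ (n + 2))) 0 (PI / 2));
  [lra|apply wallis_correct| |].
- apply (@is_RInt_plus R_NormedModule); [apply wallis_correct|].
  apply (@is_RInt_scal R_NormedModule), (@is_RInt_minus R_NormedModule); apply wallis_correct.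
- intros x [h1 h2].
  rewrite Rmult_0_l, cosh_0.
  assert (hc : 0 <= cos x) by (apply cos_ge_0; lra).
  generalize (pow_le (cos x) n hc); intros hn.
  assert (hax : 0 <= a * x) by nra.
  generalize (cosh_sub_1_le _ hax); intros h3.
  assert (h4 : cosh (a * x) <= cosh (a * (PI / 2))) by (apply cosh_le; nra).
  assert (hs : x * cos x <= sin x) by (apply mul_cos_le_sin; lra).
  generalize (sin2_cos2 x); unfold Rsqr; intros E.
  assert (hs2 : x ^ 2 * cos x ^ 2 <= sin x ^ 2).
  { replace (x ^ 2 * cos x ^ 2) with ((x * cos x) ^ 2) by ring.
    apply pow_incr; nra. }
  assert (h5 : cosh (a * x) - 1 <= C * x ^ 2).
  { unfold C. apply Rle_trans with (1 := h3).
    replace ((a * x) ^ 2 * cosh (a * x)) with (a ^ 2 * x ^ 2 * cosh (a * x)) by ring.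
    replace (a ^ 2 * cosh (a * (PI / 2)) * x ^ 2) with (a ^ 2 * x ^ 2 * cosh (a * (PI / 2)))
      by ring.
    apply Rmult_le_compat_l; [|exact h4]. nra. }
  assert (hC : 0 <= C).
  { unfold C; generalize (cosh_ge_1 (a * (PI / 2))); nra. }
  assert (h6 : (cosh (a * x) - 1) * cos x ^ 2 <= C * (1 - cos x ^ 2)).
  { apply Rle_trans with (C * x ^ 2 * cos x ^ 2); [nra|].
    rewrite Rmult_assoc; apply Rmult_le_compat_l; nra. }
  rewrite pow_add. nra.
Qed.

(** * The modulus of Gamma on the critical line *)

(** The square of the modulus of [n! / (z (z + 1) ... (z + n))] at [z = 1/2 - i t]: the
    product of the [k^2 / ((k + 1/2)^2 + t^2)], with numerator 1 at [k = 0]. *)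
Fixpoint gamma_half_sq (t : R) (n : nat) : R :=
  match n with
  | O => / ((/ 2) ^ 2 + t ^ 2)
  | S m => gamma_half_sq t m * (INR (S m) ^ 2 / ((INR (S m) + / 2) ^ 2 + t ^ 2))
  end.

(** Both sides satisfy the same first-order recurrence in [n], by [wallis_rec]. *)
Lemma gamma_half_sq_wallis (t : R) (n : nat) :
  cosh (PI * t) * gamma_half_sq t n = 4 * (wallis (2 * t) (2 * n + 1) * wallis 0 (2 * n + 1)).
Proof.
induction n as [|n IH].
- simpl (2 * 0 + 1)%nat; rewrite wallis_0_1.
  simpl gamma_half_sq.
  replace (PI * t) with (2 * t * (PI / 2)) by field.
  rewrite <- wallis_1. field. nra.
- change (gamma_half_sq t (S n)) with (gamma_half_sq t n * (INR (S n) ^ 2 / ((INR (S n) + / 2) ^ 2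
    + t ^ 2))).
  rewrite <- Rmult_assoc, IH.
  replace (2 * S n + 1)%nat with ((2 * n + 1) + 2)%nat by lia.
  generalize (wallis_rec (2 * t) (2 * n + 1)) (wallis_0_rec (2 * n + 1)).
  rewrite S_INR, !plus_INR, mult_INR; simpl (INR 2); simpl (INR 1).
  generalize (pos_INR n); intros hn.
  generalize (wallis (2 * t) (2 * n + 1)) (wallis 0 (2 * n + 1)) (wallis (2 * t) (2 * n + 1 + 2))
    (wallis 0 (2 * n + 1 + 2)).
  generalize (INR n) hn; clear.
  intros x hx A B A' B' E1 E2.
  assert (0 < (2 * t) ^ 2 + (2 * x + 1 + 2) ^ 2) by nra.
  assert (E1' : A' = (2 * x + 1 + 2) * (2 * x + 1 + 1) * A / ((2 * t) ^ 2 + (2 * x + 1 + 2) ^ 2)).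
  { replace (1 + 1) with 2 in * by ring. rewrite <- E1; field; lra. }
  assert (E2' : B' = (2 * x + 1 + 1) * B / (2 * x + 1 + 2)).
  { replace (1 + 1) with 2 in * by ring. rewrite <- E2; field; lra. }
  rewrite E1', E2'; field.
  repeat split; nra.
Qed.

Lemma gamma_half_sq_even (t : R) (n : nat) : gamma_half_sq (Rabs t) n = gamma_half_sq t n.
Proof.
generalize (pow2_abs t); intros E.
induction n as [|n IH]; unfold gamma_half_sq; fold gamma_half_sq; now rewrite ?IH, E.
Qed.

(** Wallis's formula: by monotonicity the square of an odd-indexed integral lies between
    its products with the two neighbouring ones, which [wallis_0_prod] evaluates. *)
Lemma wallis_lim : is_lim_seq (fun n => 4 * INR n * wallis 0 (2 * n + 1) ^ 2) PI.
Proof.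
assert (hd : forall c, is_lim_seq (fun n => PI / 2 * (4 * INR n / (2 * INR n + c))) PI).
{ intros c.
  apply is_lim_seq_ext_loc with (fun n => PI / 2 * (4 / (2 + c / INR n))).
  - exists 1%nat; intros n hn.
    assert (0 < INR n) by (apply lt_0_INR; lia).
    destruct (Req_dec (2 * INR n + c) 0) as [E|E].
    + replace (2 + c / INR n) with 0; [rewrite E; unfold Rdiv; rewrite !Rinv_0; ring|].
      replace c with (- 2 * INR n) by lra; field; lra.
    + field. repeat split; lra.
  - replace (Finite PI) with (Finite (PI / 2 * (4 / (2 + 0)))) by (f_equal; field).
    apply (is_lim_seq_scal_l _ (PI / 2) (4 / (2 + 0))).
    apply is_lim_seq_div'; [apply is_lim_seq_const| |lra].
    apply is_lim_seq_plus'; [apply is_lim_seq_const|].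
    unfold Rdiv; replace (Finite 0) with (Rbar_mult c 0) by (simpl; f_equal; ring).
    apply is_lim_seq_scal_l.
    apply (is_lim_seq_inv INR p_infty); [apply is_lim_seq_INR|easy]. }
apply is_lim_seq_le_le with (2 := hd 2) (3 := hd 1).
intros n.
generalize (wallis_0_prod (2 * n)) (wallis_0_prod (2 * n + 1)) (wallis_0_decr (2 * n))
  (wallis_0_decr (2 * n + 1)).
generalize (wallis_0_pos (2 * n)) (wallis_0_pos (2 * n + 1)) (wallis_0_pos (2 * n + 1 + 1)).
rewrite !plus_INR, mult_INR; simpl (INR 2); simpl (INR 1).
generalize (pos_INR n); intros hn.
generalize (wallis 0 (2 * n)) (wallis 0 (2 * n + 1)) (wallis 0 (2 * n + 1 + 1));
  intros A B D hA hB hD E1 E2 d1 d2.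
replace (1 + 1) with 2 in * by ring.
split.
- apply (Rmult_le_reg_r (2 * INR n + 2)); [lra|].
  replace (PI / 2 * (4 * INR n / (2 * INR n + 2)) * (2 * INR n + 2)) with (PI / 2 * (4 * INR n))
    by (field; lra).
  rewrite <- E2.
  replace (2 * INR n + 1 + 1) with (2 * INR n + 2) by ring.
  assert (B * D <= B ^ 2) by nra.
  replace (4 * INR n * B ^ 2 * (2 * INR n + 2)) with ((2 * INR n + 2) * (4 * INR n) * B ^ 2)
    by ring.
  replace ((2 * INR n + 2) * (B * D) * (4 * INR n)) with ((2 * INR n + 2) * (4 * INR n) * (B * D))
    by ring.
  apply Rmult_le_compat_l; [nra|easy].
- apply (Rmult_le_reg_r (2 * INR n + 1)); [lra|].
  replace (PI / 2 * (4 * INR n / (2 * INR n + 1)) * (2 * INR n + 1)) with (PI / 2 * (4 * INR n))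
    by (field; lra).
  rewrite <- E1.
  assert (B ^ 2 <= A * B) by nra.
  replace (4 * INR n * B ^ 2 * (2 * INR n + 1)) with ((2 * INR n + 1) * (4 * INR n) * B ^ 2)
    by ring.
  replace ((2 * INR n + 1) * (A * B) * (4 * INR n)) with ((2 * INR n + 1) * (4 * INR n) * (A * B))
    by ring.
  apply Rmult_le_compat_l; [nra|easy].
Qed.

(** The reflection formula on the critical line, [|Gamma (1/2 - i t)|^2 = pi / cosh (pi t)]:
    by [wallis_ge] and [wallis_le] the two factors in [gamma_half_sq_wallis] have quotient
    [1 + O(1/n)], so only Wallis's formula is left. *)
Lemma gamma_half_sq_lim (t : R) :
  is_lim_seq (fun n => INR n * gamma_half_sq t n) (PI / cosh (PI * t)).
Proof.
(* [wallis_le] is for nonnegative weights; both sides are even in [t]. *)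
assert (Hp : forall t, 0 <= t -> is_lim_seq (fun n => INR n * gamma_half_sq t n) (PI / cosh (PI *
  t))).
{ clear t; intros t ht.
  assert (hc : 1 <= cosh (PI * t)) by apply cosh_ge_1.
  apply is_lim_seq_ext with (fun n => (4 * INR n * (wallis (2 * t) (2 * n + 1) * wallis 0 (2 * n +
    1))) / cosh (PI * t)).
  { intros n. generalize (gamma_half_sq_wallis t n); intros E.
    replace (4 * INR n * (wallis (2 * t) (2 * n + 1) * wallis 0 (2 * n + 1)))
      with (INR n * (4 * (wallis (2 * t) (2 * n + 1) * wallis 0 (2 * n + 1)))) by ring.
    rewrite <- E; field; lra. }
  apply is_lim_seq_div'; [|apply is_lim_seq_const|lra].
  set (C := (2 * t) ^ 2 * cosh (2 * t * (PI / 2))).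
  apply is_lim_seq_le_le_loc with (u := fun n => 4 * INR n * wallis 0 (2 * n + 1) ^ 2)
    (w := fun n => 4 * INR n * wallis 0 (2 * n + 1) ^ 2 * (1 + C / 2 * / INR n)).
  - exists 1%nat; intros [|m] hn; [lia|].
    generalize (wallis_ge (2 * t) (2 * S m + 1)); intros h1.
    assert (h2 : wallis (2 * t) (2 * S m + 1) <=
      wallis 0 (2 * S m + 1) * (1 + C / 2 * / INR (S m))).
    { generalize (wallis_le (2 * t) (2 * m + 1) ltac:(lra)) (wallis_0_rec (2 * m + 1)).
      fold C.
      replace (2 * m + 1 + 2)%nat with (2 * S m + 1)%nat by lia.
      replace (2 * m + 1 + 1)%nat with (2 * S m)%nat by lia.
      intros h E; apply Rle_trans with (1 := h); right.
      rewrite plus_INR, mult_INR in E. simpl (INR 2) in E. simpl (INR 1) in E.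
      assert (0 < INR (S m)) by (apply lt_0_INR; lia).
      replace (wallis 0 (2 * m + 1)) with ((2 * INR (S m) + 1) * wallis 0 (2 * S m + 1) / (2 * INR
        (S m))).
      - field; lra.
      - replace (1 + 1) with 2 in E by ring. rewrite E; field; lra. }
    generalize (wallis_0_pos (2 * S m + 1)) (pos_INR (S m)); intros.
    split.
    + apply Rmult_le_compat_l; [lra|].
      rewrite <- Rsqr_pow2; apply Rmult_le_compat_r; lra.
    + rewrite (Rmult_assoc (4 * INR (S m)) (_ ^ 2)). apply Rmult_le_compat_l; [lra|].
      replace (wallis 0 (2 * S m + 1) ^ 2 * (1 + C / 2 * / INR (S m)))
        with (wallis 0 (2 * S m + 1) * (1 + C / 2 * / INR (S m)) * wallis 0 (2 * S m + 1)) by ring.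
      apply Rmult_le_compat_r; lra.
  - apply wallis_lim.
  - replace (Finite PI) with (Finite (PI * (1 + C / 2 * 0))) by (f_equal; ring).
    apply is_lim_seq_mult'; [apply wallis_lim|].
    apply is_lim_seq_plus'; [apply is_lim_seq_const|].
    apply (is_lim_seq_scal_l (fun n => / INR n) (C / 2) 0).
    apply (is_lim_seq_inv INR p_infty); [apply is_lim_seq_INR|easy]. }
replace (cosh (PI * t)) with (cosh (PI * Rabs t)).
- apply is_lim_seq_ext with (2 := Hp _ (Rabs_pos t)).
  intros n; now rewrite gamma_half_sq_even.
- unfold Rabs; destruct (Rcase_abs t); [|easy].
  unfold cosh. rewrite <- Ropp_mult_distr_r, Ropp_involutive. apply f_equal2; [ring|easy].
Qed.

(** * Differentiation of series term by term *)

Lemma ln_le_sub_1 (x : R) : 0 < x -> ln x <= x - 1.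
Proof.
intros hx.
generalize (exp_ineq1_le (ln x)); rewrite exp_ln by easy; lra.
Qed.

Lemma taylor_1_bound (f f1 f2 : R -> R) (M : R) :
  (forall x, is_derive f x (f1 x)) -> (forall x, is_derive f1 x (f2 x)) ->
  (forall x, Rabs (f2 x) <= M) ->
  forall s t, Rabs (f t - f s - f1 s * (t - s)) <= M * (t - s) ^ 2.
Proof.
intros h1 h2 hM s t.
assert (C : forall g g1 : R -> R, (forall x, is_derive g x (g1 x)) -> forall x, continuity_pt g x).
{ intros g g1 hg x. apply continuity_pt_filterlim, (ex_derive_continuous g). now exists (g1 x). }
destruct (MVT_gen f s t f1) as [c [Hc E]].
{ intros; apply h1. } { intros; now apply C with f1. }
destruct (MVT_gen f1 s c f2) as [d [Hd E']].
{ intros; apply h2. } { intros; now apply C with f2. }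
replace (f t - f s - f1 s * (t - s)) with (f2 d * ((c - s) * (t - s))) by nra.
rewrite Rabs_mult.
apply Rmult_le_compat; [apply Rabs_pos|apply Rabs_pos|apply hM|].
rewrite Rabs_pos_eq; revert Hc; unfold Rmin, Rmax; destruct (Rle_dec s t); nra.
Qed.

Lemma is_derive_of_quadratic (f : R -> R) (s l M : R) :
  (forall t, Rabs (f t - f s - l * (t - s)) <= M * (t - s) ^ 2) -> is_derive f s l.
Proof.
intros H.
apply is_derive_Reals; intros eps heps.
assert (hM : 0 < Rabs M + 1) by (generalize (Rabs_pos M); lra).
exists (mkposreal _ (Rdiv_lt_0_compat _ _ heps hM)); simpl.
intros h nh hh.
generalize (H (s + h)); replace (s + h - s) with h by ring; intros Hh.
replace ((f (s + h) - f s) / h - l) with ((f (s + h) - f s - l * h) / h) by (now field).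
unfold Rdiv; rewrite Rabs_mult, Rabs_inv.
assert (hp : 0 < Rabs h) by now apply Rabs_pos_lt.
apply (Rmult_lt_reg_r (Rabs h)); [easy|].
rewrite Rmult_assoc, Rinv_l, Rmult_1_r by lra.
apply Rle_lt_trans with (1 := Hh).
rewrite <- (pow2_abs h).
apply Rle_lt_trans with ((Rabs M + 1) * Rabs h * Rabs h).
- generalize (Rle_abs M) (Rabs_pos M); nra.
- apply Rmult_lt_compat_r; [easy|].
  apply (Rmult_lt_compat_l (Rabs M + 1)) in hh; [|easy].
  replace ((Rabs M + 1) * (eps / (Rabs M + 1))) with eps in hh by (field; lra). easy.
Qed.

(** A summable bound on the second derivatives makes the error of the first-order
    Taylor expansion summable and quadratic in the increment, so the derivative passes
    to the sum with no appeal to uniform convergence. *)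
Lemma is_derive_Series (h h1 h2 : nat -> R -> R) (M : nat -> R) :
  (forall k x, is_derive (h k) x (h1 k x)) -> (forall k x, is_derive (h1 k) x (h2 k x)) ->
  (forall k x, Rabs (h2 k x) <= M k) -> ex_series M ->
  (forall x, ex_series (fun k => h k x)) -> (forall x, ex_series (fun k => h1 k x)) ->
  forall x, is_derive (fun x => Series (fun k => h k x)) x (Series (fun k => h1 k x)).
Proof.
intros d1 d2 hM eM e e1 s.
apply is_derive_of_quadratic with (Series M).
intros t.
assert (B : forall k, Rabs (h k t - h k s - h1 k s * (t - s)) <= M k * (t - s) ^ 2).
{ intros k; now apply (taylor_1_bound (h k) (h1 k) (h2 k)). }
rewrite <- Series_scal_r, <- Series_scal_r, <- !Series_minus; try easy.
- eapply Rle_trans; [apply Series_Rabs|apply Series_le].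
  + apply (@ex_series_le R_AbsRing R_CompleteNormedModule) with (fun k => M k * (t - s) ^ 2).
    * intros k; unfold norm; simpl; unfold abs; simpl; rewrite Rabs_Rabsolu; apply B.
    * now apply ex_series_scal_r.
  + intros k; split; [apply Rabs_pos|apply B].
  + now apply ex_series_scal_r.
- now apply (@ex_series_minus R_AbsRing R_NormedModule).
- now apply ex_series_scal_r.
Qed.

(** * The argument of Gamma on the critical line *)

(** The real part of the [k]-th factor [1/2 - i t + k] in Euler's limit. *)
Definition half_int (k : nat) : R := INR k + / 2.

Lemma half_int_ge (k : nat) : / 2 <= half_int k.
Proof. unfold half_int; generalize (pos_INR k); lra. Qed.

Lemma ex_series_inv_half_sq (c : R) : ex_series (fun k => c * / half_int k ^ 2).
Proof.
apply (@ex_series_scal R_AbsRing R_NormedModule c).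
(* 8 is what the comparison with a telescoping series needs at [k = 0]. *)
apply (@ex_series_le R_AbsRing R_CompleteNormedModule)
  with (fun k => 8 * (/ (INR k + 1) - / (INR k + 2))).
- intros k; unfold norm; simpl; unfold abs; simpl.
  generalize (half_int_ge k) (pos_INR k); intros.
  rewrite Rabs_pos_eq.
  2: { left; apply Rinv_0_lt_compat. nra. }
  replace (8 * (/ (INR k + 1) - / (INR k + 2))) with (/ ((INR k + 1) * (INR k + 2) / 8))
    by (field; lra).
  apply Rinv_le_contravar; [nra|]. unfold half_int in *. nra.
- apply (@ex_series_scal R_AbsRing R_NormedModule 8).
  exists 1; change (is_lim_seq (sum_n (fun k => / (INR k + 1) - / (INR k + 2))) 1).
  apply (is_lim_seq_ext (fun n => 1 - / INR (n + 2))).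
  + intros n; rewrite plus_INR; simpl (INR 2).
    induction n as [|n IH].
    * rewrite sum_O; simpl; field.
    * rewrite sum_Sn, <- IH, S_INR; unfold plus; simpl.
      generalize (pos_INR n); intros; field; lra.
  + replace (Finite 1) with (Finite (1 - 0)) by (f_equal; ring).
    apply is_lim_seq_minus'; [apply is_lim_seq_const|].
    apply (is_lim_seq_incr_n (fun n => / INR n)).
    apply (is_lim_seq_inv INR p_infty); [apply is_lim_seq_INR|easy].
Qed.

(** The linear part [t / (k + 1/2)] is removed to make the series over [k] converge; it is
    put back by the constant [phase_slope]. *)
Definition atan_rem (k : nat) (t : R) : R := atan (t / half_int k) - t / half_int k.

Definition atan_rem1 (k : nat) (t : R) : R := half_int k / (half_int k ^ 2 + t ^ 2) - / half_int k.

Definition atan_rem2 (k : nat) (t : R) : R := - (2 * half_int k * t) / (half_int k ^ 2 + t ^ 2) ^ 2.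

Definition atan_rem3 (k : nat) (t : R) : R :=
  half_int k * (6 * t ^ 2 - 2 * half_int k ^ 2) / (half_int k ^ 2 + t ^ 2) ^ 3.

Lemma is_derive_atan_rem (k : nat) (t : R) : is_derive (atan_rem k) t (atan_rem1 k t).
Proof.
generalize (half_int_ge k); intros ha; unfold atan_rem, atan_rem1.
evar_last.
- apply (is_derive_minus (fun t => atan (t / half_int k)) (fun t => t / half_int k)).
  + apply (is_derive_comp atan (fun t => t / half_int k)); [apply is_derive_atan|].
    auto_derive; [lra|reflexivity].
  + auto_derive; [lra|reflexivity].
- unfold minus, plus, opp, scal; simpl; unfold mult; simpl; unfold Rsqr.
  field. split; nra.
Qed.

Lemma is_derive_atan_rem1 (k : nat) (t : R) : is_derive (atan_rem1 k) t (atan_rem2 k t).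
Proof.
generalize (half_int_ge k); intros ha; unfold atan_rem1, atan_rem2.
auto_derive; [nra|]. field; nra.
Qed.

Lemma is_derive_atan_rem2 (k : nat) (t : R) : is_derive (atan_rem2 k) t (atan_rem3 k t).
Proof.
generalize (half_int_ge k); intros ha; unfold atan_rem2, atan_rem3.
assert (0 < half_int k ^ 2 + t ^ 2) by nra.
auto_derive.
- apply Rgt_not_eq. replace (half_int k * (half_int k * 1) + t * (t * 1))
    with (half_int k ^ 2 + t ^ 2) by ring. nra.
- field; nra.
Qed.

Lemma atan_rem2_bound (k : nat) (t : R) : Rabs (atan_rem2 k t) <= 1 * / half_int k ^ 2.
Proof.
generalize (half_int_ge k); intros ha; unfold atan_rem2.
set (a := half_int k) in *.
assert (hp : 0 < a ^ 2 + t ^ 2) by nra.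
unfold Rdiv; rewrite Rabs_mult, Rabs_Ropp, (Rabs_pos_eq (/ _)).
2: { left; apply Rinv_0_lt_compat; nra. }
apply Rle_trans with (/ (a ^ 2 + t ^ 2)).
- apply (Rmult_le_reg_r ((a ^ 2 + t ^ 2) ^ 2)); [nra|].
  rewrite Rmult_assoc, Rinv_l by nra.
  replace (/ (a ^ 2 + t ^ 2) * (a ^ 2 + t ^ 2) ^ 2) with (a ^ 2 + t ^ 2) by (field; lra).
  rewrite Rmult_1_r; apply Rabs_le.
  generalize (pow2_ge_0 (a - t)) (pow2_ge_0 (a + t)); nra.
- rewrite Rmult_1_l; apply Rinv_le_contravar; nra.
Qed.

Lemma atan_rem3_bound (k : nat) (t : R) : Rabs (atan_rem3 k t) <= 12 * / half_int k ^ 2.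
Proof.
generalize (half_int_ge k); intros ha; unfold atan_rem3.
set (a := half_int k) in *.
assert (hp : 0 < a ^ 2 + t ^ 2) by nra.
unfold Rdiv; rewrite !Rabs_mult, (Rabs_pos_eq (/ _)), (Rabs_pos_eq a) by
  (try (left; apply Rinv_0_lt_compat, pow_lt); lra).
apply Rle_trans with (6 * a * / (a ^ 2 + t ^ 2) ^ 2).
- apply (Rmult_le_reg_r ((a ^ 2 + t ^ 2) ^ 3)); [now apply pow_lt|].
  rewrite Rmult_assoc, Rinv_l by (apply Rgt_not_eq; now apply pow_lt).
  replace (6 * a * / (a ^ 2 + t ^ 2) ^ 2 * (a ^ 2 + t ^ 2) ^ 3) with (a * (6 * (a ^ 2 + t ^ 2)))
    by (field; lra).
  rewrite Rmult_1_r; apply Rmult_le_compat_l; [lra|]. apply Rabs_le; nra.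
- apply Rle_trans with (6 * a * / (a ^ 2) ^ 2).
  + apply Rmult_le_compat_l; [lra|]. apply Rinv_le_contravar; [apply pow_lt; nra|].
    apply pow_incr; nra.
  + replace (6 * a * / (a ^ 2) ^ 2) with (6 * / a * / a ^ 2) by (field; lra).
    apply Rmult_le_compat_r; [left; apply Rinv_0_lt_compat; nra|].
    replace 12 with (6 * / / 2) by field.
    apply Rmult_le_compat_l; [lra|]. apply Rinv_le_contravar; lra.
Qed.

Lemma ex_series_of_inv_half_sq_bound (h : nat -> R -> R) (c : R -> R) :
  (forall k t, Rabs (h k t) <= c t * / half_int k ^ 2) -> forall t, ex_series (fun k => h k t).
Proof.
intros H t.
apply (@ex_series_le R_AbsRing R_CompleteNormedModule) with (fun k => c t * / half_int k ^ 2).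
- intros k; apply H.
- apply ex_series_inv_half_sq.
Qed.

Lemma ex_series_atan_rem (t : R) : ex_series (fun k => atan_rem k t).
Proof.
apply (ex_series_of_inv_half_sq_bound atan_rem (fun t => t ^ 2)); clear t; intros k t.
generalize (half_int_ge k); intros ha.
generalize (taylor_1_bound (atan_rem k) (atan_rem1 k) (atan_rem2 k) _ (is_derive_atan_rem k)
  (is_derive_atan_rem1 k) (atan_rem2_bound k) 0 t).
replace (atan_rem k t - atan_rem k 0 - atan_rem1 k 0 * (t - 0)) with (atan_rem k t).
- intros h; apply Rle_trans with (1 := h); right; ring.
- unfold atan_rem, atan_rem1; unfold Rdiv; rewrite Rmult_0_l, atan_0; field; lra.
Qed.

Lemma ex_series_atan_rem1 (t : R) : ex_series (fun k => atan_rem1 k t).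
Proof.
apply (ex_series_of_inv_half_sq_bound atan_rem1 (fun t => 2 * t ^ 2)); clear t; intros k t.
generalize (half_int_ge k); intros ha; unfold atan_rem1.
set (a := half_int k) in *.
assert (hp : 0 < a ^ 2 + t ^ 2) by nra.
replace (a / (a ^ 2 + t ^ 2) - / a) with (- (/ a * t ^ 2 * / (a ^ 2 + t ^ 2))) by (field; lra).
assert (0 < / a) by (apply Rinv_0_lt_compat; lra).
assert (0 < / (a ^ 2 + t ^ 2)) by (apply Rinv_0_lt_compat; lra).
assert (0 <= t ^ 2) by apply pow2_ge_0.
rewrite Rabs_Ropp, Rabs_pos_eq.
- apply Rmult_le_compat; try nra.
  + apply Rmult_le_compat_r; [easy|].
    replace 2 with (/ / 2) by field. apply Rinv_le_contravar; lra.
  + apply Rinv_le_contravar; nra.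
- apply Rmult_le_pos; nra.
Qed.

Lemma ex_series_atan_rem2 (t : R) : ex_series (fun k => atan_rem2 k t).
Proof. exact (ex_series_of_inv_half_sq_bound atan_rem2 (fun _ => 1) atan_rem2_bound t). Qed.

(** The argument of the [n]-th term in Euler's limit at [1/2 - i t]. *)
Definition gamma_phase_n (t : R) (n : nat) : R :=
  sum_n (fun k => atan (t / half_int k)) n - t * ln (INR n).

(** An Euler constant for the numbers [k + 1/2]: the sequence decreases, because
    [1/(n + 1/2) <= 1/n <= ln (n / (n - 1))], and is bounded below by comparison of
    [1/a] with [ln ((a + 1) / a)]. *)
Lemma half_harmonic_lim : exists L : R,
  is_lim_seq (fun n => sum_n (fun k => / half_int k) n - ln (INR n)) L.
Proof.
pose (u := fun n => sum_n (fun k => / half_int k) n - ln (INR n)).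
(* The shift avoids the value of [ln] at 0. *)
assert (H : ex_finite_lim_seq (fun n => u (S n))).
{ apply (ex_finite_lim_seq_decr (fun n => u (S n)) 0).
  - intros n; unfold u.
    rewrite (sum_Sn _ (S n)); unfold plus; simpl (AbelianMonoid.plus _ _).
    assert (hn : 0 < INR (S n)) by (apply lt_0_INR; lia).
    assert (E : ln (INR (S n) / INR (S (S n))) <= - / INR (S (S n))).
    { eapply Rle_trans; [apply ln_le_sub_1|].
      - apply Rdiv_lt_0_compat; [easy|apply lt_0_INR; lia].
      - rewrite (S_INR (S n)); right; field; lra. }
    rewrite ln_div in E by (apply lt_0_INR; lia).
    assert (/ half_int (S (S n)) <= / INR (S (S n))).
    { apply Rinv_le_contravar; [apply lt_0_INR; lia|unfold half_int; lra]. }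
    cbn -[INR sum_n ln half_int]. lra.
  - intros n; unfold u.
    assert (H : forall n, ln (2 * INR n + 3) <= sum_n (fun k => / half_int k) n).
    { clear n; intros n. induction n as [|n IH].
      - rewrite sum_O. unfold half_int; simpl (INR 0).
        eapply Rle_trans; [apply ln_le_sub_1; lra|]. lra.
      - rewrite sum_Sn; unfold plus; simpl (AbelianMonoid.plus _ _).
        apply Rle_trans with (ln (2 * INR n + 3) + / half_int (S n)).
        2: cbn -[INR sum_n ln half_int]; lra.
        rewrite S_INR.
        generalize (pos_INR n); intros hn.
        assert (E : ln ((2 * (INR n + 1) + 3) / (2 * INR n + 3)) <= / half_int (S n)).
        { eapply Rle_trans; [apply ln_le_sub_1|].
          - apply Rdiv_lt_0_compat; lra.
          - unfold half_int; rewrite S_INR; right; field; lra. }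
        rewrite ln_div in E by lra. lra. }
    assert (hn : 0 < INR (S n)) by (apply lt_0_INR; lia).
    assert (ln (INR (S n)) <= ln (2 * INR (S n) + 3)) by (apply ln_le; lra).
    generalize (H (S n)); lra. }
destruct H as [L HL].
exists L. now apply is_lim_seq_incr_1 in HL.
Qed.

Definition phase_slope : R := real (Lim_seq (fun n => sum_n (fun k => / half_int k) n - ln (INR
  n))).

Lemma phase_slope_lim :
  is_lim_seq (fun n => sum_n (fun k => / half_int k) n - ln (INR n)) phase_slope.
Proof.
destruct half_harmonic_lim as [L HL]; unfold phase_slope.
now rewrite (is_lim_seq_unique _ _ HL).
Qed.

(** The continuous argument of [Gamma (1/2 - i t)] that vanishes at [t = 0]. *)
Definition gamma_phase (t : R) : R := phase_slope * t + Series (fun k => atan_rem k t).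

Definition gamma_phase1 (t : R) : R := phase_slope + Series (fun k => atan_rem1 k t).

Definition gamma_phase2 (t : R) : R := Series (fun k => atan_rem2 k t).

Lemma gamma_phase_lim (t : R) : is_lim_seq (gamma_phase_n t) (gamma_phase t).
Proof.
apply is_lim_seq_ext with (fun n => t * (sum_n (fun k => / half_int k) n - ln (INR n)) + sum_n
  (fun k => atan_rem k t) n).
- intros n; unfold gamma_phase_n, atan_rem.
  rewrite Rmult_minus_distr_l, <- (sum_n_mult_l (K := R_Ring) t).
  assert (E : forall k, atan (t / half_int k) = plus (mult t (/ half_int k)) (atan (t / half_int
    k) - t / half_int k)).
  { intros k; unfold plus, mult; simpl; unfold Rdiv; ring. }
  rewrite (sum_n_ext _ _ n E), sum_n_plus.
  assert (EE : forall A B C : R, A - C + B = A + B - C) by (intros; ring).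
  apply EE.
- unfold gamma_phase; rewrite (Rmult_comm _ t).
  apply is_lim_seq_plus'.
  + apply (is_lim_seq_scal_l _ t phase_slope), phase_slope_lim.
  + apply Series_correct, ex_series_atan_rem.
Qed.

Lemma is_derive_gamma_phase (t : R) : is_derive gamma_phase t (gamma_phase1 t).
Proof.
apply (is_derive_plus (fun t => phase_slope * t) (fun t => Series (fun k => atan_rem k t))).
- auto_derive; [trivial|ring].
- apply is_derive_Series with atan_rem2 (fun k => 1 * / half_int k ^ 2).
  + apply is_derive_atan_rem.
  + apply is_derive_atan_rem1.
  + apply atan_rem2_bound.
  + apply ex_series_inv_half_sq.
  + apply ex_series_atan_rem.
  + apply ex_series_atan_rem1.
Qed.

Lemma is_derive_gamma_phase1 (t : R) : is_derive gamma_phase1 t (gamma_phase2 t).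
Proof.
replace (gamma_phase2 t) with (0 + gamma_phase2 t) by ring.
apply (is_derive_plus (fun t => phase_slope) (fun t => Series (fun k => atan_rem1 k t))).
- auto_derive; [trivial|ring].
- apply is_derive_Series with atan_rem3 (fun k => 12 * / half_int k ^ 2).
  + apply is_derive_atan_rem1.
  + apply is_derive_atan_rem2.
  + apply atan_rem3_bound.
  + apply ex_series_inv_half_sq.
  + apply ex_series_atan_rem1.
  + apply ex_series_atan_rem2.
Qed.

Lemma gamma_phase2_neg (t : R) : 0 < t -> gamma_phase2 t <= 0.
Proof.
intros ht.
assert (H : 0 <= Series (fun k => - atan_rem2 k t)).
{ rewrite <- (Rmult_0_l (Series (fun k => - atan_rem2 k t))), <- Series_scal_l.
  apply Series_le.
  - intros k. rewrite Rmult_0_l.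
    generalize (half_int_ge k); intros.
    split; [lra|]. unfold atan_rem2.
    replace (- (- (2 * half_int k * t) / (half_int k ^ 2 + t ^ 2) ^ 2))
      with (2 * half_int k * t / (half_int k ^ 2 + t ^ 2) ^ 2).
    + assert (0 < (half_int k ^ 2 + t ^ 2)) by nra.
      left; apply Rdiv_lt_0_compat; nra.
    + field; nra.
  - apply (@ex_series_opp R_AbsRing R_NormedModule), ex_series_atan_rem2. }
rewrite Series_opp in H; unfold gamma_phase2; lra.
Qed.

(** * The phase and its concavity *)

(** [atan (e^(pi t)) - pi/4] is the argument of [sin (pi s / 2)] at [s = 1/2 + i t]. *)
Definition theta (t : R) : R :=
  t * ln (2 * PI) + gamma_phase t + (atan (exp (PI * t)) - PI / 4).

Definition theta1 (t : R) : R :=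
  ln (2 * PI) + gamma_phase1 t + PI * exp (PI * t) / (1 + exp (PI * t) ^ 2).

Definition theta2 (t : R) : R :=
  gamma_phase2 t
  + PI ^ 2 * exp (PI * t) * (1 - exp (PI * t) ^ 2) / (1 + exp (PI * t) ^ 2) ^ 2.

Lemma is_derive_theta (t : R) : is_derive theta t (theta1 t).
Proof.
apply (is_derive_plus (fun t => t * ln (2 * PI) + gamma_phase t) (fun t => atan (exp (PI * t)) -
  PI / 4)).
- apply (is_derive_plus (fun t => t * ln (2 * PI)) gamma_phase).
  + auto_derive; [trivial|ring].
  + apply is_derive_gamma_phase.
- evar_last.
  + apply (is_derive_minus (fun t => atan (exp (PI * t))) (fun _ => PI / 4)).
    * apply (is_derive_comp atan (fun t => exp (PI * t))); [apply is_derive_atan|].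
      auto_derive; [trivial|reflexivity].
    * apply is_derive_const.
  + unfold minus, plus, opp, zero, scal; simpl; unfold mult; simpl; unfold Rsqr.
    field. nra.
Qed.

Lemma is_derive_theta1 (t : R) : is_derive theta1 t (theta2 t).
Proof.
apply (is_derive_plus (fun t => ln (2 * PI) + gamma_phase1 t)
  (fun t => PI * exp (PI * t) / (1 + exp (PI * t) ^ 2))).
- replace (gamma_phase2 t) with (0 + gamma_phase2 t) by ring.
  apply (is_derive_plus (fun t => ln (2 * PI)) gamma_phase1).
  + auto_derive; [trivial|ring].
  + apply is_derive_gamma_phase1.
- auto_derive; [nra|]. field. nra.
Qed.

Lemma theta2_neg (t : R) : 0 < t -> theta2 t < 0.
Proof.
intros ht; unfold theta2.
generalize (gamma_phase2_neg t ht) PI_RGT_0; intros h1 hp.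
assert (he : 1 < exp (PI * t)).
{ rewrite <- exp_0; apply exp_increasing; nra. }
set (x := exp (PI * t)) in *.
assert (0 < PI ^ 2 * x * (x ^ 2 - 1) / (1 + x ^ 2) ^ 2).
{ apply Rdiv_lt_0_compat; [|nra]. apply Rmult_lt_0_compat; [|nra].
  apply Rmult_lt_0_compat; nra. }
replace (PI ^ 2 * x * (1 - x ^ 2) / (1 + x ^ 2) ^ 2)
  with (- (PI ^ 2 * x * (x ^ 2 - 1) / (1 + x ^ 2) ^ 2)) by (field; nra).
lra.
Qed.

(** * The factor of the functional equation as a pure phase *)

Definition cis (x : R) : C := Cexp (Ci * x).

Lemma cis_eq (x : R) : cis x = (cos x, sin x).
Proof.
unfold cis, Cexp, Ci, Cmult, RtoC, Re, Im; simpl.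
replace (0 * x - 1 * 0) with 0 by ring.
replace (0 * 0 + 1 * x) with x by ring.
now rewrite exp_0, !Rmult_1_l.
Qed.

Lemma cis_plus (x y : R) : cis (x + y) = (cis x * cis y)%C.
Proof.
rewrite !cis_eq; unfold Cmult; simpl.
rewrite cos_plus, sin_plus; f_equal; ring.
Qed.

Lemma cis_0 : cis 0 = 1%C.
Proof. now rewrite cis_eq, cos_0, sin_0. Qed.

Lemma cis_nonzero (x : R) : cis x <> 0%C.
Proof.
intros E; apply C1_nz.
generalize (cis_plus x (- x)); rewrite Rplus_opp_r, cis_0, E, Cmult_0_l; easy.
Qed.

Lemma Cexp_polar (z : C) : Cexp z = (RtoC (exp (Re z)) * cis (Im z))%C.
Proof.
rewrite cis_eq; unfold Cexp, Cmult, RtoC; simpl; f_equal; ring.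
Qed.

(** On [a > 0] the argument needs no correction by [pi]. *)
Lemma polar_atan (a t : R) : 0 < a ->
  (a, t) = (RtoC (sqrt (a ^ 2 + t ^ 2)) * cis (atan (t / a)))%C.
Proof.
intros ha.
assert (hp : 0 < a ^ 2 + t ^ 2) by nra.
assert (E : sqrt (1 + (t / a)²) = sqrt (a ^ 2 + t ^ 2) / a).
{ replace (1 + (t / a)²) with ((a ^ 2 + t ^ 2) / a ^ 2) by (unfold Rsqr; field; lra).
  rewrite sqrt_div_alt by (try apply pow_lt; nra). rewrite sqrt_pow2 by lra; easy. }
assert (hs : 0 < sqrt (a ^ 2 + t ^ 2)) by now apply sqrt_lt_R0.
rewrite cis_eq, cos_atan, sin_atan, E.
generalize dependent (sqrt (a ^ 2 + t ^ 2)); intros q _ hq.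
unfold Cmult, RtoC; simpl; f_equal; field; lra.
Qed.

Lemma inv_polar_atan (a t : R) : 0 < a ->
  (/ ((a, (- t)%R) : C) = RtoC (/ sqrt (a ^ 2 + t ^ 2)) * cis (atan (t / a)))%C.
Proof.
intros ha.
assert (hp : 0 < a ^ 2 + t ^ 2) by nra.
assert (hs : 0 < sqrt (a ^ 2 + t ^ 2)) by now apply sqrt_lt_R0.
rewrite (polar_atan a (- t) ha).
replace ((- t) ^ 2) with (t ^ 2) by ring.
replace (- t / a) with (- (t / a)) by (field; lra).
rewrite atan_opp.
set (q := sqrt (a ^ 2 + t ^ 2)) in *.
assert (N : RtoC q <> 0%C) by (intros E; apply RtoC_inj in E; lra).
assert (E : (cis (- atan (t / a)) * cis (atan (t / a)) = 1)%C).
{ now rewrite <- cis_plus, Rplus_opp_l, cis_0. }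
rewrite RtoC_inv by lra.
generalize (cis_nonzero (- atan (t / a))); intros N'.
rewrite <- (Cmult_1_l (/ _)), <- E. field; split; easy.
Qed.

Lemma gamma_half_sq_pos (t : R) (n : nat) : 0 < gamma_half_sq t n.
Proof.
induction n as [|n IH].
- simpl; apply Rinv_0_lt_compat; nra.
- change (0 < gamma_half_sq t n * (INR (S n) ^ 2 / ((INR (S n) + / 2) ^ 2 + t ^ 2))).
  assert (0 < INR (S n)) by (apply lt_0_INR; lia).
  apply Rmult_lt_0_compat; [easy|]. apply Rdiv_lt_0_compat; nra.
Qed.

Lemma fact_div_rising (t : R) (n : nat) :
  (RtoC (INR (fact n)) / rising ((/ 2)%R, (- t)%R) (S n)
   = RtoC (sqrt (gamma_half_sq t n)) * cis (sum_n (fun k => atan (t / half_int k)) n))%C.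
Proof.
assert (Ek : forall k : nat, (((/ 2)%R, (- t)%R) + RtoC (INR k) = (half_int k, (- t)%R))%C).
{ intros k; unfold Cplus, RtoC, half_int; simpl; f_equal; ring. }
assert (Hk : forall k, ((half_int k, (- t)%R) : C) <> 0%C).
{ intros k E; apply (f_equal Re) in E; cbn -[half_int] in E; generalize (half_int_ge k); lra. }
assert (Hr : forall m, rising ((/ 2)%R, (- t)%R) m <> 0%C).
{ intros m; induction m as [|m IHm]; [exact C1_nz|].
  apply Cmult_neq_0; [exact IHm|]. rewrite Ek; apply Hk. }
induction n as [|n IH].
- rewrite sum_O.
  change (rising ((/ 2)%R, (- t)%R) 1) with (1 * (((/ 2)%R, (- t)%R) + RtoC (INR 0)))%C.
  rewrite Ek, Cmult_1_l. unfold Cdiv; simpl (INR (fact 0)); rewrite Cmult_1_l.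
  rewrite inv_polar_atan by (generalize (half_int_ge 0); lra).
  f_equal. f_equal. simpl gamma_half_sq.
  rewrite <- sqrt_inv. unfold half_int; simpl INR. do 2 f_equal. ring.
- rewrite sum_Sn.
  change (plus (sum_n (fun k => atan (t / half_int k)) n) (atan (t / half_int (S n))))
    with (sum_n (fun k => atan (t / half_int k)) n + atan (t / half_int (S n))).
  change (rising ((/ 2)%R, (- t)%R) (S (S n)))
    with (rising ((/ 2)%R, (- t)%R) (S n) * (((/ 2)%R, (- t)%R) + RtoC (INR (S n))))%C.
  rewrite Ek, fact_simpl, mult_INR, RtoC_mult, cis_plus.
  generalize (Hr (S n)) (Hk (S n)); intros N1 N2.
  set (rr := rising _ (S n)) in *.
  change (gamma_half_sq t (S n)) with (gamma_half_sq t n * (INR (S n) ^ 2 / (half_int (S n) ^ 2 +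
    t ^ 2))).
  assert (hn : 0 < INR (S n)) by (apply lt_0_INR; lia).
  generalize (half_int_ge (S n)); intros hh.
  rewrite sqrt_mult_alt by (left; apply gamma_half_sq_pos).
  rewrite sqrt_div_alt by (try apply pow_lt; nra). rewrite sqrt_pow2 by lra.
  unfold Cdiv in *; unfold Rdiv.
  replace (/ (rr * (half_int (S n), (- t)%R)))%C with (/ rr * / ((half_int (S n), (- t)%R) : C))%C
    by (field; now split).
  rewrite inv_polar_atan by lra.
  rewrite !RtoC_mult.
  transitivity (RtoC (INR (fact n)) * / rr * (INR (S n) * (RtoC (/ sqrt (half_int (S n) ^ 2 + t ^
    2)) * cis (atan (t / half_int (S n))))))%C.
  { unfold Rdiv. ring. }
  rewrite IH. unfold Rdiv; ring.
Qed.

Lemma exp_half_ln (x : R) : 0 < x -> exp (/ 2 * ln x) = sqrt x.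
Proof.
intros hx. rewrite <- Rpower_sqrt by easy. reflexivity.
Qed.

Lemma Rcpow_polar (x a b : R) : Rcpow x (a, b) = (RtoC (exp (a * ln x)) * cis (b * ln x))%C.
Proof.
unfold Rcpow; rewrite Cexp_polar.
replace (Re ((a, b) * RtoC (ln x))) with (a * ln x) by (simpl; ring).
replace (Im ((a, b) * RtoC (ln x))) with (b * ln x) by (simpl; ring).
reflexivity.
Qed.

Lemma Clim_seq_polar (u : nat -> C) (r p : nat -> R) (r0 p0 : R) :
  is_lim_seq r r0 -> is_lim_seq p p0 ->
  eventually (fun n => u n = (RtoC (r n) * cis (p n))%C) ->
  Clim_seq u = (RtoC r0 * cis p0)%C.
Proof.
intros hr hp hu.
assert (E : forall r p, (RtoC r * cis p)%C = (r * cos p, r * sin p)).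
{ intros; rewrite cis_eq; unfold Cmult, RtoC; simpl; f_equal; ring. }
rewrite E; unfold Clim_seq; f_equal.
- rewrite (is_lim_seq_unique _ (r0 * cos p0)); [easy|].
  apply is_lim_seq_ext_loc with (fun n => r n * cos (p n)).
  + revert hu; apply filter_imp; intros n ->; now rewrite E.
  + apply is_lim_seq_mult'; [easy|].
    apply is_lim_seq_continuous; [apply continuity_cos|easy].
- rewrite (is_lim_seq_unique _ (r0 * sin p0)); [easy|].
  apply is_lim_seq_ext_loc with (fun n => r n * sin (p n)).
  + revert hu; apply filter_imp; intros n ->; now rewrite E.
  + apply is_lim_seq_mult'; [easy|].
    apply is_lim_seq_continuous; [apply continuity_sin|easy].
Qed.

Lemma CGamma_half (t : R) :
  CGamma ((/ 2)%R, (- t)%R) = (RtoC (sqrt (PI / cosh (PI * t))) * cis (gamma_phase t))%C.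
Proof.
unfold CGamma.
apply Clim_seq_polar with (r := fun n => sqrt (INR n * gamma_half_sq t n)) (p := gamma_phase_n t).
- apply is_lim_seq_continuous; [|apply gamma_half_sq_lim].
  apply continuity_pt_filterlim, continuous_sqrt.
- apply gamma_phase_lim.
- exists 1%nat; intros n hn.
  assert (h0 : 0 < INR n) by (apply lt_0_INR; lia).
  rewrite Rcpow_polar, exp_half_ln by easy.
  rewrite sqrt_mult_alt by lra.
  transitivity (RtoC (sqrt (INR n)) * cis (- t * ln (INR n)) * (RtoC (INR (fact n)) / rising ((/
    2)%R, (- t)%R) (S n)))%C.
  { unfold Cdiv; ring. }
  rewrite fact_div_rising.
  unfold gamma_phase_n.
  replace (sum_n (fun k => atan (t / half_int k)) n - t * ln (INR n))
   with (- t * ln (INR n) + sum_n (fun k => atan (t / half_int k)) n) by (lra).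
  rewrite cis_plus, RtoC_mult. ring.
Qed.

(** With [y = e^(pi t / 2)], the sine is [e^(- i pi / 4) (1/y + i y) / 2]. *)
Lemma Csin_quarter (t : R) :
  Csin ((PI / 4)%R, (PI * t / 2)%R)
  = (RtoC (sqrt (2 * cosh (PI * t)) / 2) * cis (atan (exp (PI * t)) - PI / 4))%C.
Proof.
set (y := exp (PI * t / 2)).
assert (hy : 0 < y) by apply exp_pos.
assert (Ey : exp (PI * t) = y ^ 2).
{ unfold y; simpl; rewrite Rmult_1_r, <- exp_plus; f_equal; field. }
assert (Ey' : exp (- (PI * t / 2)) = / y) by apply exp_Ropp.
assert (E1 : (1 / y, y) = (RtoC (sqrt (2 * cosh (PI * t))) * cis (atan (exp (PI * t))))%C).
{ rewrite (polar_atan (1 / y) y).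
  - f_equal; f_equal; f_equal.
    + unfold cosh; rewrite exp_Ropp, Ey; field; lra.
    + rewrite Ey; field; lra.
  - apply Rdiv_lt_0_compat; lra. }
unfold Rminus; rewrite cis_plus.
unfold Rdiv at 3; rewrite RtoC_mult.
transitivity (RtoC (/ 2) * cis (- (PI / 4)) * ((1 / y)%R, y))%C.
2: { rewrite E1; ring. }
unfold Csin; rewrite !Cexp_polar, !cis_eq.
unfold Ci, RtoC, Cdiv, Cinv, Cmult, Cminus, Cplus, Copp, Re, Im; simpl.
rewrite cos_neg, sin_neg.
replace (0 * (PI / 4) - 1 * (PI * t / 2)) with (- (PI * t / 2)) by ring.
replace (0 * (PI * t / 2) + 1 * (PI / 4)) with (PI / 4) by ring.
rewrite !Ropp_involutive.
rewrite cos_neg, sin_neg, Ey'. fold y.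
rewrite cos_PI4, sin_PI4.
assert (0 < sqrt 2) by (apply sqrt_lt_R0; lra).
f_equal; field; lra.
Qed.

(** The moduli are [sqrt 2], [1 / sqrt pi], [sqrt (pi / cosh (pi t))] and
    [sqrt (2 cosh (pi t)) / 2]; their product is 1. *)
Lemma zDelta_half (t : R) : zDelta (/ 2 + Ci * t) = cis (theta t).
Proof.
assert (E0 : (/ RtoC 2)%C = ((/ 2)%R, 0)).
{ rewrite <- RtoC_inv by lra; reflexivity. }
assert (E : (/ 2 + Ci * t)%C = ((/ 2)%R, t)).
{ rewrite E0. unfold Cplus, Cmult, Ci, RtoC; simpl; f_equal; ring. }
rewrite E; unfold zDelta.
replace (((/ 2)%R, t) - 1)%C with ((- / 2)%R, t).
2: { unfold Cminus, Cplus, Copp, RtoC; simpl; f_equal; field. }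
replace (1 - ((/ 2)%R, t))%C with ((/ 2)%R, (- t)%R).
2: { unfold Cminus, Cplus, Copp, RtoC; simpl; f_equal; field. }
replace (PI * ((/ 2)%R, t) / 2)%C with ((PI / 4)%R, (PI * t / 2)%R).
2: { unfold Cdiv. rewrite E0. unfold Cmult, RtoC; simpl; f_equal; field. }
rewrite !Rcpow_polar, CGamma_half, Csin_quarter.
generalize PI_RGT_0 (cosh_ge_1 (PI * t)); intros hp hc.
rewrite <- Ropp_mult_distr_l, exp_Ropp, !exp_half_ln by lra.
unfold theta; rewrite !cis_plus.
rewrite ln_mult, Rmult_plus_distr_l, cis_plus by lra.
transitivity (RtoC (sqrt 2 * / sqrt PI * sqrt (PI / cosh (PI * t)) * (sqrt (2 * cosh (PI * t)) / 2))
  * (cis (t * ln 2) * cis (t * ln PI) * cis (gamma_phase t)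
  * cis (atan (exp (PI * t)) - PI / 4)))%C.
{ rewrite !RtoC_mult; ring. }
match goal with |- (RtoC ?r * _ = _)%C => replace r with 1; [ring|] end.
rewrite sqrt_div_alt, sqrt_mult_alt by lra.
assert (0 < sqrt PI) by (apply sqrt_lt_R0; lra).
assert (0 < sqrt (cosh (PI * t))) by (apply sqrt_lt_R0; lra).
assert (E2 : sqrt 2 * sqrt 2 = 2) by (apply sqrt_sqrt; lra).
replace (sqrt 2 * / sqrt PI * (sqrt PI / sqrt (cosh (PI * t))) * (sqrt 2 * sqrt (cosh (PI * t)) /
  2))
  with (sqrt 2 * sqrt 2 / 2) by (field; lra).
rewrite E2; field.
Qed.

(** * The growth of the phase *)

Definition atan_primitive (t x : R) : R := x * atan (t / x) + t / 2 * ln (x ^ 2 + t ^ 2).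

Lemma is_derive_atan_primitive (t x : R) : 0 < x -> is_derive (atan_primitive t) x (atan (t / x)).
Proof.
intros hx; unfold atan_primitive.
evar_last.
- apply (is_derive_plus (fun x => x * atan (t / x)) (fun x => t / 2 * ln (x ^ 2 + t ^ 2))).
  + apply (is_derive_mult (fun x => x) (fun x => atan (t / x))).
    * apply (is_derive_id (K := R_AbsRing)).
    * apply (is_derive_comp atan (fun x => t / x)); [apply is_derive_atan|].
      auto_derive; [lra|reflexivity].
    * intros; apply Rmult_comm.
  + auto_derive; [nra|reflexivity].
- unfold plus, scal, mult, one; simpl; unfold mult; simpl; unfold Rsqr.
  field. split; nra.
Qed.

Lemma atan_primitive_step (t x : R) : 0 < t -> 0 < x ->
  atan (t / (x + 1)) <= atan_primitive t (x + 1) - atan_primitive t x <= atan (t / x).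
Proof.
intros ht hx.
destruct (MVT_gen (atan_primitive t) x (x + 1) (fun x => atan (t / x))) as [c [Hc E]].
- intros z Hz; rewrite Rmin_left in Hz by lra; apply is_derive_atan_primitive; lra.
- intros z Hz; rewrite Rmin_left in Hz by lra.
  apply continuity_pt_filterlim, (ex_derive_continuous (atan_primitive t)).
  eexists; apply is_derive_atan_primitive; lra.
- rewrite Rmin_left, Rmax_right in Hc by lra.
  rewrite E. replace (x + 1 - x) with 1 by ring. rewrite Rmult_1_r.
  assert (H : forall u v, 0 < u <= v -> atan (t / v) <= atan (t / u)).
  { intros u v [hu hv]. destruct (Req_dec u v) as [->|]; [lra|].
    left; apply atan_increasing. apply Rmult_lt_compat_l; [easy|].
    apply Rinv_lt_contravar; nra. }
  split; apply H; lra.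
Qed.

(** Comparison of a decreasing summand with its integral; the first term, at most
    [pi/2], absorbs the error. *)
Lemma sum_atan_bounds (t : R) (n : nat) : 0 < t ->
  atan_primitive t (half_int (S n)) - atan_primitive t (half_int 0)
    <= sum_n (fun k => atan (t / half_int k)) n
    <= PI / 2 + (atan_primitive t (half_int n) - atan_primitive t (half_int 0)).
Proof.
intros ht.
assert (Eh : forall n, half_int (S n) = half_int n + 1) by (intros; unfold half_int;
  rewrite S_INR; ring).
assert (B : forall n, atan (t / half_int (S n)) <=
  atan_primitive t (half_int (S n)) - atan_primitive t (half_int n) <= atan (t / half_int n)).
{ intros k; rewrite !Eh; apply atan_primitive_step; [easy|]. generalize (half_int_ge k); lra. }
induction n as [|n IH].
- rewrite sum_O. generalize (B O) (atan_bound (t / half_int 0)); lra.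
- rewrite sum_Sn.
  match goal with |- _ <= plus ?a ?b <= _ => change (plus a b) with (a + b) end.
  generalize (B n) (B (S n)); lra.
Qed.

(** The primitive at the upper end [n + 1/2] contributes at most
    [t + t ln n + o(1)], and at the lower end [1/2] at least [t ln t]. *)
Lemma gamma_phase_upper (t : R) : 1 <= t -> gamma_phase t <= t - t * ln t + PI / 2.
Proof.
intros ht.
assert (H : Rbar_le (gamma_phase t) (t - t * ln t + PI / 2 + t / 2 * (0 + (/ 4 + t ^ 2) * 0)));
  [|simpl in H; lra].
apply is_lim_seq_le_loc with (gamma_phase_n t)
  (fun n => t - t * ln t + PI / 2 + t / 2 * (/ INR n + (/ 4 + t ^ 2) * (/ INR n * / INR n))).
- exists 1%nat; intros n hn.
  assert (h0 : 0 < INR n) by (apply lt_0_INR; lia).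
  unfold gamma_phase_n.
  destruct (sum_atan_bounds t n ltac:(lra)) as [_ B].
  unfold atan_primitive in B.
  generalize (half_int_ge n); intros hh.
  assert (E1 : half_int n * atan (t / half_int n) <= t).
  { assert (Hat : atan (t / half_int n) <= t / half_int n).
    { assert (hx : 0 < t / half_int n) by (apply Rdiv_lt_0_compat; lra).
      destruct (MVT_gen atan 0 (t / half_int n) (fun x => / (1 + x²))) as [c [Hc E]].
      - intros; apply is_derive_atan.
      - intros; apply derivable_continuous_pt, derivable_pt_atan.
      - rewrite atan_0 in E.
        assert (/ (1 + c²) <= 1).
        { rewrite <- Rinv_1. apply Rinv_le_contravar; [lra|]. generalize (Rle_0_sqr c); lra. }
        nra. }
    apply Rle_trans with (half_int n * (t / half_int n)).
    - apply Rmult_le_compat_l; lra.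
    - right; field; lra. }
  assert (E2 : 0 <= half_int 0 * atan (t / half_int 0)).
  { apply Rmult_le_pos; [generalize (half_int_ge 0); lra|].
    left; rewrite <- atan_0; apply atan_increasing.
    apply Rdiv_lt_0_compat; [lra|generalize (half_int_ge 0); lra]. }
  assert (E3 : ln (half_int n ^ 2 + t ^ 2) - 2 * ln (INR n) <=
    / INR n + (/ 4 + t ^ 2) * (/ INR n * / INR n)).
  { replace (2 * ln (INR n)) with (ln (INR n ^ 2)).
    2: { rewrite ln_pow by easy; simpl; ring. }
    rewrite <- ln_div by nra.
    eapply Rle_trans; [apply ln_le_sub_1|].
    - apply Rdiv_lt_0_compat; nra.
    - right; unfold half_int; field; lra. }
  assert (E4 : 2 * ln t <= ln (half_int 0 ^ 2 + t ^ 2)).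
  { replace (2 * ln t) with (ln (t ^ 2)).
    - apply ln_le; [nra|]. generalize (pow2_ge_0 (half_int 0)); lra.
    - rewrite ln_pow by lra; simpl; ring. }
  nra.
- apply gamma_phase_lim.
- assert (Hi : is_lim_seq (fun n => / INR n) 0).
  { apply (is_lim_seq_inv INR p_infty); [apply is_lim_seq_INR|easy]. }
  apply is_lim_seq_plus'; [apply is_lim_seq_const|].
  apply (is_lim_seq_scal_l _ (t / 2) (0 + (/ 4 + t ^ 2) * 0)).
  apply is_lim_seq_plus'; [easy|].
  apply (is_lim_seq_scal_l _ (/ 4 + t ^ 2) 0).
  replace (Finite 0) with (Finite (0 * 0)) by (f_equal; ring).
  now apply is_lim_seq_mult'.
Qed.

(** The primitive at the upper end contributes at least [t + t ln n - o(1)], and at the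
    lower end [1/2] at most [t ln t + pi/4 + 1/8]. *)
Lemma gamma_phase_lower (t : R) : 1 <= t -> t - t * ln t - PI / 4 - / 8 <= gamma_phase t.
Proof.
intros ht.
assert (H : Rbar_le (t - t * ln t - PI / 4 - / 8 - t ^ 3 * (0 * 0)) (gamma_phase t));
  [|simpl in H; lra].
apply is_lim_seq_le_loc with
  (fun n => t - t * ln t - PI / 4 - / 8 - t ^ 3 * (/ INR n * / INR n)) (gamma_phase_n t).
- exists 1%nat; intros n hn.
  assert (h0 : 0 < INR n) by (apply lt_0_INR; lia).
  unfold gamma_phase_n.
  destruct (sum_atan_bounds t n ltac:(lra)) as [B _].
  unfold atan_primitive in B.
  generalize (half_int_ge (S n)); intros hh.
  assert (hS : INR n <= half_int (S n)) by (unfold half_int; rewrite S_INR; lra).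
  assert (E1 : t - t ^ 3 * (/ INR n * / INR n) <= half_int (S n) * atan (t / half_int (S n))).
  { set (m := half_int (S n)) in *.
    assert (hx : 0 < t / m) by (apply Rdiv_lt_0_compat; lra).
    destruct (MVT_gen atan 0 (t / m) (fun x => / (1 + x²))) as [c [Hc E]].
    - intros; apply is_derive_atan.
    - intros; apply derivable_continuous_pt, derivable_pt_atan.
    - rewrite atan_0 in E.
      rewrite Rmin_left, Rmax_right in Hc by lra.
      assert (hc : c ^ 2 <= (t / m) ^ 2) by (apply pow_incr; lra).
      assert (hc' : 1 - (t / m) ^ 2 <= / (1 + c²)).
      { apply Rle_trans with (1 - c ^ 2); [lra|].
        apply (Rmult_le_reg_r (1 + c²)); unfold Rsqr; [nra|].
        rewrite Rinv_l by nra. nra. }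
      replace (atan (t / m)) with (/ (1 + c²) * (t / m)) by lra.
      replace (m * (/ (1 + c²) * (t / m))) with (/ (1 + c²) * t) by (field; unfold Rsqr; split;
        nra).
      apply Rle_trans with ((1 - (t / m) ^ 2) * t).
      + replace ((1 - (t / m) ^ 2) * t) with (t - t ^ 3 * (/ m * / m)) by (field; lra).
        assert (/ m * / m <= / INR n * / INR n).
        { assert (/ m <= / INR n) by (apply Rinv_le_contravar; lra).
          assert (0 < / m) by (apply Rinv_0_lt_compat; lra). nra. }
        assert (0 < t ^ 3) by (apply pow_lt; lra). nra.
      + apply Rmult_le_compat_r; lra. }
  assert (E2 : half_int 0 * atan (t / half_int 0) <= PI / 4).
  { unfold half_int at 1; simpl (INR 0). generalize (atan_bound (t / half_int 0)); lra. }
  assert (E3 : 2 * ln (INR n) <= ln (half_int (S n) ^ 2 + t ^ 2)).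
  { replace (2 * ln (INR n)) with (ln (INR n ^ 2)).
    - apply ln_le; nra.
    - rewrite ln_pow by lra; simpl; ring. }
  assert (E4 : t / 2 * ln (half_int 0 ^ 2 + t ^ 2) <= t * ln t + / 8).
  { replace (half_int 0 ^ 2 + t ^ 2) with (t ^ 2 * (1 + / (4 * t ^ 2))) by (unfold half_int;
      simpl INR; field; lra).
    assert (0 < / (4 * t ^ 2)) by (apply Rinv_0_lt_compat; nra).
    rewrite ln_mult, ln_pow by nra. simpl (INR 2).
    assert (Hl : ln (1 + / (4 * t ^ 2)) <= / (4 * t ^ 2)).
    { eapply Rle_trans; [apply ln_le_sub_1; lra|lra]. }
    assert (t / 2 * ln (1 + / (4 * t ^ 2)) <= / 8).
    { apply Rle_trans with (t / 2 * / (4 * t ^ 2)); [apply Rmult_le_compat_l; lra|].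
      replace (t / 2 * / (4 * t ^ 2)) with (/ (8 * t)) by (field; lra).
      apply Rinv_le_contravar; lra. }
    lra. }
  nra.
- assert (Hi : is_lim_seq (fun n => / INR n) 0).
  { apply (is_lim_seq_inv INR p_infty); [apply is_lim_seq_INR|easy]. }
  apply is_lim_seq_minus'; [apply is_lim_seq_const|].
  apply (is_lim_seq_scal_l _ (t ^ 3) (0 * 0)).
  now apply is_lim_seq_mult'.
- apply gamma_phase_lim.
Qed.

Lemma theta_asymptotic (T : R) : 1 <= T ->
  Rabs (theta T + T * ln (T / (2 * PI * exp 1))) <= PI.
Proof.
intros hT.
generalize PI_RGT_0 (gamma_phase_upper T hT) (gamma_phase_lower T hT) PI2_3_2 (atan_bound (exp (PI
  * T))); intros hp U L h3 A.
assert (A0 : 0 < atan (exp (PI * T))).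
{ rewrite <- atan_0; apply atan_increasing, exp_pos. }
unfold theta.
rewrite ln_div, (ln_mult (2 * PI)), ln_exp by (try apply exp_pos; lra || (apply Rmult_lt_0_compat;
  [lra|apply exp_pos])).
apply Rabs_le; split; lra.
Qed.

(** * Monotonicity of the phase *)

Lemma theta_continuous (t : R) : continuous theta t.
Proof. apply (ex_derive_continuous theta); eexists; apply is_derive_theta. Qed.

Lemma theta_bounded (T : R) : 0 < T -> exists B, forall t, 0 < t <= T -> Rabs (theta t) <= B.
Proof.
intros hT.
assert (hc : forall c, 0 <= c <= T -> continuity_pt theta c).
{ intros c _; apply continuity_pt_filterlim, theta_continuous. }
destruct (continuity_ab_maj theta 0 T ltac:(lra) hc) as [M [HM _]].
destruct (continuity_ab_min theta 0 T ltac:(lra) hc) as [m [Hm _]].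
exists (Rabs (theta M) + Rabs (theta m)); intros t ht.
generalize (HM t ltac:(lra)) (Hm t ltac:(lra)).
unfold Rabs; destruct (Rcase_abs (theta t)), (Rcase_abs (theta M)), (Rcase_abs (theta m)); lra.
Qed.

Lemma theta_mvt (s t : R) : s < t ->
  exists c, s <= c <= t /\ theta t - theta s = theta1 c * (t - s).
Proof.
intros h.
destruct (MVT_gen theta s t theta1) as [c [Hc E]].
- intros; apply is_derive_theta.
- intros; apply continuity_pt_filterlim, theta_continuous.
- rewrite Rmin_left, Rmax_right in Hc by lra. now exists c.
Qed.

Lemma theta1_decr (s t : R) : 0 < s < t -> theta1 t < theta1 s.
Proof.
intros [hs ht].
destruct (MVT_gen theta1 s t theta2) as [c [Hc E]].
- intros; apply is_derive_theta1.
- intros; apply continuity_pt_filterlim, (ex_derive_continuous theta1).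
  exists (theta2 x); apply is_derive_theta1.
- rewrite Rmin_left, Rmax_right in Hc by lra.
  generalize (theta2_neg c ltac:(lra)); nra.
Qed.

Lemma theta1_decr_le (s t : R) : 0 < s <= t -> theta1 t <= theta1 s.
Proof.
intros [h1 [h2| ->]]; [|lra]. left; now apply theta1_decr.
Qed.

(** By concavity a negative slope at the left end is enough. *)
Lemma theta_decr (s t : R) : 0 < s < t -> theta1 s < 0 -> theta t < theta s.
Proof.
intros [hs h] Hs.
destruct (theta_mvt s t h) as [c [Hc Ec]].
generalize (theta1_decr_le s c ltac:(lra)); nra.
Qed.

Lemma theta_inj_incr (s t : R) : 0 < s -> 0 < t -> 0 < theta1 s -> 0 < theta1 t ->
  theta s = theta t -> s = t.
Proof.
intros hs ht Hs Ht E.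
destruct (Rtotal_order s t) as [h|[h|h]]; [exfalso|easy|exfalso].
- destruct (theta_mvt s t h) as [c [Hc Ec]].
  generalize (theta1_decr_le c t ltac:(lra)); nra.
- destruct (theta_mvt t s h) as [c [Hc Ec]].
  generalize (theta1_decr_le c s ltac:(lra)); nra.
Qed.

Lemma theta_inj_decr (s t : R) : 0 < s -> 0 < t -> theta1 s < 0 -> theta1 t < 0 ->
  theta s = theta t -> s = t.
Proof.
intros hs ht Hs Ht E.
destruct (Rtotal_order s t) as [h|[h|h]]; [exfalso|easy|exfalso].
- generalize (theta_decr s t ltac:(lra) Hs); lra.
- generalize (theta_decr t s ltac:(lra) Ht); lra.
Qed.

(** The phase tends to minus infinity, so its slope is negative somewhere. *)
Lemma exists_theta1_neg : exists t0, 0 < t0 /\ theta1 t0 < 0.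
Proof.
set (M := Rmax 1 (PI - theta 1 + 1)).
assert (hM : 1 <= M /\ PI - theta 1 + 1 <= M) by (split; [apply Rmax_l|apply Rmax_r]).
assert (hp := PI2_3_2).
assert (he : 2 < exp 1) by (generalize (exp_ineq1 1); lra).
assert (heM : 1 + M <= exp M) by apply exp_ineq1_le.
(* With this [T], [ln (T / (2 pi e)) = M] and [T > 1]. *)
set (T := 2 * PI * exp 1 * exp M).
assert (hT : 1 < T).
{ unfold T. assert (6 < 2 * PI * exp 1) by nra. nra. }
generalize (theta_asymptotic T ltac:(lra)).
replace (T / (2 * PI * exp 1)) with (exp M) by (unfold T; field; lra).
rewrite ln_exp; intros [_ H]%Rabs_le_between.
destruct (theta_mvt 1 T hT) as [c [Hc E]].
exists c; split; [lra|].
assert (M <= T * M) by nra.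
nra.
Qed.

(** * Order of vanishing *)

Lemma continuous_pair (f g : R -> R) (t : R) :
  continuous f t -> continuous g t ->
  @continuous R_UniformSpace C_UniformSpace (fun t => (f t, g t)) t.
Proof.
intros hf hg P [e He].
assert (H1 : locally t (fun s => ball (f t) e (f s))) by (apply hf; now exists e).
assert (H2 : locally t (fun s => ball (g t) e (g s))) by (apply hg; now exists e).
change (locally t (fun s => P (f s, g s))).
generalize (filter_and _ _ H1 H2); apply filter_imp; intros s [h1 h2]; apply He; now split.
Qed.

(** A Peano expansion [S t = l (t - t0)^m + o((t - t0)^m)] with [l <> 0] is just
    continuity at [t0] of the quotient by [(t - t0)^m], completed by the value [l].  For
    [m > 0] it forces [S t0 = 0]. *)
Lemma zero_of_order_peano (S : R -> R) (u : R -> C) (t0 l : R) (m : nat) :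
  (forall eps : posreal, locally t0 (fun t =>
     Rabs (S t - l * (t - t0) ^ m) <= eps * Rabs (t - t0) ^ m)) ->
  l <> 0 -> continuous u t0 -> u t0 <> 0%C ->
  zero_of_order (fun t => (RtoC (S t) * u t)%C) t0 m.
Proof.
intros H hl hc hu.
pose (q := fun t => if Req_dec_T t t0 then l else S t / (t - t0) ^ m).
assert (Hq : forall t, S t = (t - t0) ^ m * q t).
{ intros t; unfold q; destruct (Req_dec_T t t0) as [->|n].
  - rewrite Rminus_diag.
    destruct (Req_dec (S t0) (0 ^ m * l)) as [|N]; [easy|exfalso].
    assert (N' : 0 < Rabs (S t0 - l * 0 ^ m)) by (apply Rabs_pos_lt; lra).
    assert (Hh : 0 < Rabs (S t0 - l * 0 ^ m) / 2) by lra.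
    generalize (locally_singleton _ _ (H (mkposreal _ Hh))); simpl pos.
    rewrite Rminus_diag, Rabs_R0.
    assert (0 ^ m <= 1) by (destruct m; simpl; lra).
    nra.
  - field. apply pow_nonzero; lra. }
exists (fun t => RtoC (q t) * u t)%C.
assert (q0 : q t0 = l) by (unfold q; destruct (Req_dec_T t0 t0); easy).
repeat split.
- apply (continuous_ext (fun t : R => @scal _ C_R_NormedModule (q t) (u t))).
  { intros t; apply scal_R_Cmult. }
  apply (@continuous_scal R_UniformSpace R_AbsRing C_R_NormedModule); [|exact hc].
  intros P [e He].
  assert (he : 0 < e / 2) by (destruct e as [e h]; simpl; lra).
  change (locally t0 (fun t => P (q t))).
  generalize (H (mkposreal _ he)); apply filter_imp; simpl pos.
  intros t Ht; apply He; rewrite q0.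
  change (Rabs (q t - l) < e).
  unfold q; destruct (Req_dec_T t t0) as [|n].
  + rewrite Rminus_diag, Rabs_R0; apply cond_pos.
  + assert (hp : 0 < Rabs ((t - t0) ^ m)) by (apply Rabs_pos_lt, pow_nonzero; lra).
    rewrite RPow_abs in Ht.
    apply (Rmult_lt_reg_r (Rabs ((t - t0) ^ m))); [easy|].
    rewrite <- Rabs_mult.
    replace ((S t / (t - t0) ^ m - l) * (t - t0) ^ m) with (S t - l * (t - t0) ^ m)
      by (field; apply pow_nonzero; lra).
    nra.
- rewrite q0; apply Cmult_neq_0; [|exact hu].
  intros E; apply RtoC_inj in E; easy.
- exists (mkposreal 1 Rlt_0_1); intros t _.
  rewrite Hq, RtoC_mult, RtoC_pow; ring.
Qed.

Lemma is_derive_peano (S : R -> R) (t0 l : R) : S t0 = 0 -> is_derive S t0 l ->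
  forall eps : posreal, locally t0 (fun t => Rabs (S t - l * (t - t0) ^ 1) <=
    eps * Rabs (t - t0) ^ 1).
Proof.
intros h0 [_ H] eps.
generalize (H t0 (fun P HP => HP) eps); apply filter_imp; intros t.
unfold norm, minus, plus, opp, scal; simpl; unfold abs, mult; simpl.
rewrite h0, !Rmult_1_r.
now replace (S t + - 0 + - ((t + - t0) * l)) with (S t - l * (t - t0)) by ring.
Qed.

Lemma is_derive_2_peano (S S1 : R -> R) (t0 l : R) :
  S t0 = 0 -> S1 t0 = 0 -> (forall t, is_derive S t (S1 t)) -> is_derive S1 t0 l ->
  forall eps : posreal, locally t0 (fun t => Rabs (S t - l / 2 * (t - t0) ^ 2) <=
    eps * Rabs (t - t0) ^ 2).
Proof.
intros h0 h1 H1 H2 eps.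
destruct (is_derive_peano S1 t0 l h1 H2 eps) as [d Hd].
exists d; intros t Ht.
change (Rabs (t - t0) < d) in Ht.
(* The mean value theorem is applied to the remainder: applied to [S] it would lose
   the factor 1/2. *)
pose (r := fun t => S t - l / 2 * (t - t0) ^ 2).
assert (Dr : forall t, is_derive r t (S1 t - l * (t - t0))).
{ intros s; apply (is_derive_minus S (fun t => l / 2 * (t - t0) ^ 2)); [apply H1|].
  auto_derive; [trivial|field]. }
destruct (MVT_gen r t0 t (fun t => S1 t - l * (t - t0))) as [c [Hc E]].
- intros; apply Dr.
- intros x _; apply continuity_pt_filterlim, (ex_derive_continuous r). eexists; apply Dr.
- assert (r0 : r t0 = 0) by (unfold r; rewrite h0; ring).
  rewrite r0, Rminus_0_r in E.
  change (Rabs (r t) <= eps * Rabs (t - t0) ^ 2); rewrite E, Rabs_mult.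
  assert (hc : Rabs (c - t0) <= Rabs (t - t0)).
  { revert Hc; unfold Rmin, Rmax, Rabs; destruct (Rle_dec t0 t), (Rcase_abs (c - t0)),
      (Rcase_abs (t - t0)); lra. }
  assert (B : Rabs (S1 c - l * (c - t0)) <= eps * Rabs (t - t0)).
  { generalize (Hd c (Rle_lt_trans _ _ _ hc Ht)); simpl; rewrite !Rmult_1_r; intros h.
    apply Rle_trans with (1 := h). apply Rmult_le_compat_l; [left; apply cond_pos|easy]. }
  simpl; rewrite Rmult_1_r, <- Rmult_assoc.
  apply Rmult_le_compat_r; [apply Rabs_pos|easy].
Qed.

(** A chord of the unit circle is a real multiple of a unit vector.  This reduces the
    order of the complex function [e^(i theta) - e^(2 i phi)] to that of a real sine. *)
Lemma cis_chord (x y : R) :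
  (cis x - cis y = RtoC (2 * sin ((x - y) / 2)) * (- sin ((x + y) / 2), cos ((x + y) / 2))%R)%C.
Proof.
rewrite !cis_eq; unfold Cminus, Cplus, Copp, Cmult, RtoC; simpl.
generalize (form2 x y) (form4 x y); intros E1 E2.
f_equal; [fold (Rminus (cos x) (cos y)); rewrite E1|fold (Rminus (sin x) (sin y)); rewrite E2];
  ring.
Qed.

Lemma Derive_theta (t : R) : Derive (fun x : R => theta x) t = theta1 t.
Proof. exact (is_derive_unique _ _ _ (is_derive_theta t)). Qed.

Lemma Derive_theta1 (t : R) : Derive (fun x : R => theta1 x) t = theta2 t.
Proof. exact (is_derive_unique _ _ _ (is_derive_theta1 t)). Qed.

(** * The roots and their multiplicities *)

Definition root_function (phi : R) (t : R) : C := (zDelta (/ 2 + Ci * t) - Cexp (2 * Ci * phi))%C.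

Definition level (phi : R) (k : Z) : R := 2 * phi + 2 * PI * IZR k.

Definition sine_factor (phi : R) (t : R) : R := 2 * sin ((theta t - 2 * phi) / 2).

Definition unit_factor (phi : R) (t : R) : C :=
  (- sin ((theta t + 2 * phi) / 2), cos ((theta t + 2 * phi) / 2)).

Lemma root_function_factor (phi : R) (t : R) :
  root_function phi t = (RtoC (sine_factor phi t) * unit_factor phi t)%C.
Proof.
unfold root_function; rewrite zDelta_half.
replace (2 * Ci * phi)%C with (Ci * RtoC (2 * phi))%C by (rewrite RtoC_mult; ring).
apply cis_chord.
Qed.

Lemma unit_factor_continuous (phi : R) (t : R) : continuous (unit_factor phi) t.
Proof.
assert (H : continuous (fun t => (theta t + 2 * phi) / 2) t).
{ apply (ex_derive_continuous (fun t => (theta t + 2 * phi) / 2)).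
  exists (theta1 t / 2).
  evar_last; [auto_derive; [eexists; apply is_derive_theta|reflexivity]|].
  rewrite Derive_theta; field. }
apply continuous_pair.
- apply (continuous_comp _ (fun x => - sin x)); [exact H|].
  apply (ex_derive_continuous (fun x => - sin x)); auto_derive; trivial.
- apply (continuous_comp _ cos); [exact H|].
  apply continuous_cos.
Qed.

Lemma unit_factor_nonzero (phi : R) (t : R) : unit_factor phi t <> 0%C.
Proof.
unfold unit_factor; set (x := (theta t + 2 * phi) / 2); intros E.
generalize (f_equal fst E) (f_equal snd E) (sin2_cos2 x); simpl; unfold Rsqr; nra.
Qed.

Definition sine_factor1 (phi : R) (t : R) : R := cos ((theta t - 2 * phi) / 2) * theta1 t.

Lemma is_derive_sine_factor (phi : R) (t : R) : is_derive (sine_factor phi) t (sine_factor1 phi t).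
Proof.
unfold sine_factor, sine_factor1.
evar_last; [auto_derive; [eexists; apply is_derive_theta|reflexivity]|].
rewrite Derive_theta; unfold Rdiv, Rminus; field.
Qed.

Lemma is_derive_sine_factor1 (phi : R) (t : R) : is_derive (sine_factor1 phi) t
  (cos ((theta t - 2 * phi) / 2) * theta2 t - sin ((theta t - 2 * phi) / 2) * theta1 t ^ 2 / 2).
Proof.
unfold sine_factor1.
evar_last; [auto_derive; [split; [eexists; apply is_derive_theta|split;[eexists;
  apply is_derive_theta1|easy]]|reflexivity]|].
rewrite Derive_theta, Derive_theta1;
  unfold Rdiv, Rminus; field.
Qed.

Lemma sine_factor_0 (phi : R) (t : R) : sine_factor phi t = 0 <-> exists k, theta t = level phi k.
Proof.
unfold sine_factor, level; split.
- intros E. destruct (sin_eq_0_0 ((theta t - 2 * phi) / 2)) as [k Hk]; [lra|].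
  exists k; lra.
- intros [k Hk]. rewrite Hk.
  replace ((2 * phi + 2 * PI * IZR k - 2 * phi) / 2) with (IZR k * PI) by field.
  rewrite (sin_eq_0_1 (IZR k * PI)); [ring|now exists k].
Qed.

Lemma cos_nonzero_of_sin_0 (x : R) : sin x = 0 -> cos x <> 0.
Proof. generalize (sin2_cos2 x); unfold Rsqr; nra. Qed.

Lemma zero_of_order_root_function (phi : R) (t : R) (m : nat) :
  zero_of_order (fun t => RtoC (sine_factor phi t) * unit_factor phi t)%C t m ->
  zero_of_order (root_function phi) t m.
Proof.
intros [g [h1 [h2 h3]]]; exists g; repeat split; try easy.
revert h3; apply filter_imp; intros s <-; apply root_function_factor.
Qed.

Lemma root_order_0 (phi : R) (t : R) : ~ (exists k, theta t = level phi k) ->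
  zero_of_order (root_function phi) t 0.
Proof.
intros N; apply zero_of_order_root_function, zero_of_order_peano with (sine_factor phi t).
- intros eps.
  assert (hc : continuous (sine_factor phi) t).
  { apply (ex_derive_continuous (sine_factor phi)); eexists; apply is_derive_sine_factor. }
  assert (H : locally t (fun s => ball (sine_factor phi t) eps (sine_factor phi s))) by (apply hc;
    now exists eps).
  revert H; apply filter_imp; intros s Hs; simpl; rewrite !Rmult_1_r; left; exact Hs.
- rewrite sine_factor_0; exact N.
- apply unit_factor_continuous.
- apply unit_factor_nonzero.
Qed.

Lemma root_order_1 (phi : R) (t : R) : (exists k, theta t = level phi k) -> theta1 t <> 0 ->
  zero_of_order (root_function phi) t 1.
Proof.
intros Hk%sine_factor_0 N; apply zero_of_order_root_function, zero_of_order_peano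
  with (sine_factor1 phi t).
- apply is_derive_peano; [easy|apply is_derive_sine_factor].
- apply Rmult_integral_contrapositive_currified; [|easy].
  apply cos_nonzero_of_sin_0; unfold sine_factor in Hk; lra.
- apply unit_factor_continuous.
- apply unit_factor_nonzero.
Qed.

Lemma root_order_2 (phi : R) (t : R) : (exists k, theta t = level phi k) -> theta1 t = 0 ->
  theta2 t <> 0 ->
  zero_of_order (root_function phi) t 2.
Proof.
intros Hk%sine_factor_0 E N; apply zero_of_order_root_function.
assert (hs : sin ((theta t - 2 * phi) / 2) = 0) by (unfold sine_factor in Hk; lra).
apply zero_of_order_peano with (cos ((theta t - 2 * phi) / 2) * theta2 t / 2).
- apply is_derive_2_peano with (sine_factor1 phi); try easy.
  + unfold sine_factor1; rewrite E; ring.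
  + apply is_derive_sine_factor.
  + generalize (is_derive_sine_factor1 phi t); rewrite hs, E.
    replace (cos ((theta t - 2 * phi) / 2) * theta2 t - 0 * 0 ^ 2 / 2)
      with (cos ((theta t - 2 * phi) / 2) * theta2 t) by field.
    easy.
- generalize (cos_nonzero_of_sin_0 _ hs); intros.
  assert (cos ((theta t - 2 * phi) / 2) * theta2 t <> 0)
    by now apply Rmult_integral_contrapositive_currified.
  lra.
- apply unit_factor_continuous.
- apply unit_factor_nonzero.
Qed.

(** * Counting the roots *)

Lemma level_inj (phi : R) (j k : Z) : level phi j = level phi k -> j = k.
Proof.
unfold level; intros E. apply eq_IZR.
generalize PI_RGT_0; intros. apply (Rmult_eq_reg_l (2 * PI)); lra.
Qed.

(** Levels are treated one at a time: injectivity of [theta] on [D] leaves at most one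
    root per level, and the list has full length when no level is missed. *)
Lemma list_of_roots (phi : R) (D : R -> Prop) (ks : list Z) :
  (forall s t, D s -> D t -> theta s = theta t -> s = t) -> NoDup ks ->
  exists l, NoDup l /\ (forall t, In t l <-> D t /\ exists k, In k ks /\ theta t = level phi k) /\
    ((forall k, In k ks -> exists t, D t /\ theta t = level phi k) -> length l = length ks).
Proof.
intros hD; induction ks as [|k ks IH]; intros hN.
- exists []; split; [constructor|split; [|easy]].
  intros t; split; [easy|]. intros [_ [k [[] _]]].
- inversion hN as [|? ? hk hN']; subst.
  destruct (IH hN') as [l [h1 [h2 h3]]].
  destruct (classic (exists t, D t /\ theta t = level phi k)) as [[t [Dt Et]]|N].
  + exists (t :: l); split; [|split].
    * constructor; [|easy]. rewrite h2; intros [_ [j [Hj Ej]]].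
      rewrite Et in Ej; apply level_inj in Ej; congruence.
    * intros s; simpl; rewrite h2; split.
      -- intros [<-|[Ds [j [Hj Ej]]]]; [split; [easy|exists k; tauto]|split; [easy|exists j;
           tauto]].
      -- intros [Ds [j [[<-|Hj] Ej]]]; [left; apply hD; congruence|right; split;
           [easy|now exists j]].
    * intros H; simpl; f_equal; apply h3. intros j Hj; apply H; now right.
  + exists l; split; [easy|split].
    * intros s; rewrite h2; split.
      -- intros [Ds [j [Hj Ej]]]; split; [easy|exists j; split; [now right|easy]].
      -- intros [Ds [j [[<-|Hj] Ej]]]; [exfalso; apply N; now exists s|split; [easy|now exists j]].
    * intros H; exfalso; apply N, H; now left.
Qed.

(** Half-open on the right, like the range of levels met on [(t0, T]] by a decreasing phase. *)
Definition Zrange (a b : Z) : list Z :=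
  map (fun i => (a + Z.of_nat i)%Z) (seq 0 (Z.to_nat (b - a))).

Lemma in_Zrange (a b k : Z) : In k (Zrange a b) <-> (a <= k < b)%Z.
Proof.
unfold Zrange; rewrite in_map_iff; split.
- intros [i [<- Hi%in_seq]]; lia.
- intros H; exists (Z.to_nat (k - a)); rewrite in_seq; lia.
Qed.

Lemma NoDup_Zrange (a b : Z) : NoDup (Zrange a b).
Proof.
apply FinFun.Injective_map_NoDup; [|apply seq_NoDup].
intros i j; lia.
Qed.

Lemma length_Zrange (a b : Z) : length (Zrange a b) = Z.to_nat (b - a).
Proof. unfold Zrange; now rewrite length_map, length_seq. Qed.

Lemma list_of_roots_bounded (phi : R) (D : R -> Prop) (B : R) :
  (forall s t, D s -> D t -> theta s = theta t -> s = t) ->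
  (forall t, D t -> Rabs (theta t) <= B) ->
  exists l, NoDup l /\ forall t, In t l <-> D t /\ exists k, theta t = level phi k.
Proof.
intros hD hB.
(* A level met on [D] is at most [B] in absolute value. *)
set (M := up (B + Rabs (2 * phi))).
destruct (list_of_roots phi D (Zrange (- M) M) hD (NoDup_Zrange _ _)) as [l [h1 [h2 _]]].
exists l; split; [easy|]; intros t; rewrite h2; split.
- intros [Dt [k [_ Hk]]]; split; [easy|now exists k].
- intros [Dt [k Hk]]; split; [easy|exists k; split; [|easy]].
  apply in_Zrange.
  destruct (archimed (B + Rabs (2 * phi))) as [A _]; fold M in A.
  assert (H : Rabs (IZR k) < IZR M).
  { apply Rle_lt_trans with (2 := A).
    apply Rle_trans with (Rabs (2 * PI * IZR k)).
    - rewrite Rabs_mult, (Rabs_pos_eq (2 * PI)) by (generalize PI_RGT_0; lra).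
      generalize PI2_3_2 (Rabs_pos (IZR k)); nra.
    - replace (2 * PI * IZR k) with (theta t - 2 * phi) by (rewrite Hk; unfold level; ring).
      eapply Rle_trans; [apply Rabs_triang|]. rewrite Rabs_Ropp.
      generalize (hB t Dt); lra. }
  apply Rabs_def2 in H; destruct H as [H1 H2].
  rewrite <- opp_IZR in H2; apply lt_IZR in H1; apply lt_IZR in H2; lia.
Qed.

(** The phase is injective where its slope is positive and where it is negative, and its
    critical point is unique.  The root list of the third part is taken twice because
    a root at the critical point is double. *)
Lemma number_of_zeros_exists (phi : R) (T : R) : 0 < T -> exists n,
  number_of_zeros (root_function phi) T n.
Proof.
intros hT.
destruct (theta_bounded T hT) as [B HB].
destruct (list_of_roots_bounded phi (fun t => 0 < t <= T /\ 0 < theta1 t) B) as [l1 [n1 i1]].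
{ intros s t [hs h1] [ht h2]; apply theta_inj_incr; lra. } { intros t [ht _]; now apply HB. }
destruct (list_of_roots_bounded phi (fun t => 0 < t <= T /\ theta1 t < 0) B) as [l2 [n2 i2]].
{ intros s t [hs h1] [ht h2]; apply theta_inj_decr; lra. } { intros t [ht _]; now apply HB. }
destruct (list_of_roots_bounded phi (fun t => 0 < t <= T /\ theta1 t = 0) B) as [l3 [n3 i3]].
{ intros s t [hs h1] [ht h2] _.
  destruct (Rtotal_order s t) as [h|[h|h]]; [exfalso|easy|exfalso].
  - generalize (theta1_decr s t ltac:(lra)); lra.
  - generalize (theta1_decr t s ltac:(lra)); lra. }
{ intros t [ht _]; now apply HB. }
exists (length (l1 ++ l2 ++ l3 ++ l3)), (l1 ++ l2 ++ l3 ++ l3); split; [|easy].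
split.
- intros t Ht; rewrite !in_app_iff, i1, i2, i3 in Ht; tauto.
- intros t ht.
  rewrite !count_occ_app.
  assert (C0 : forall l, ~ In t l -> count_occ Req_dec_T l t = 0%nat) by (intros;
    now apply count_occ_not_In).
  assert (C1 : forall l, NoDup l -> In t l -> count_occ Req_dec_T l t = 1%nat) by (intros;
    now apply NoDup_count_occ').
  destruct (classic (exists k, theta t = level phi k)) as [Hk|N].
  + destruct (Rtotal_order (theta1 t) 0) as [h|[h|h]].
    * rewrite (C0 l1), (C0 l3), (C1 l2) by (try easy; rewrite ?i1, ?i2, ?i3; (tauto || lra)).
      apply root_order_1; [easy|lra].
    * rewrite (C0 l1), (C0 l2), (C1 l3) by (try easy; rewrite ?i1, ?i2, ?i3; (tauto || lra)).
      apply root_order_2; [easy|easy|]. generalize (theta2_neg t); lra.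
    * rewrite (C0 l2), (C0 l3), (C1 l1) by (try easy; rewrite ?i1, ?i2, ?i3; (tauto || lra)).
      apply root_order_1; [easy|lra].
  + rewrite (C0 l1), (C0 l2), (C0 l3) by (rewrite ?i1, ?i2, ?i3; tauto).
    now apply root_order_0.
Qed.

(** The ceiling, written with [up], the least integer greater than a real. *)
Definition Zceil (x : R) : Z := (1 - up (- x))%Z.

Lemma Zceil_bounds (x : R) : x <= IZR (Zceil x) < x + 1.
Proof.
unfold Zceil; rewrite minus_IZR.
destruct (archimed (- x)); lra.
Qed.

(** The levels met run from [theta T], included, to [theta t0], excluded, each met exactly
    once: at least once by the intermediate value theorem, at most once by monotonicity. *)
Lemma tail_count (phi : R) (t0 T : R) : 0 < t0 < T -> theta1 t0 < 0 ->
  exists l, NoDup l /\ (forall t, In t l <-> t0 < t <= T /\ exists k, theta t = level phi k) /\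
    Rabs (INR (length l) - (theta t0 - theta T) / (2 * PI)) <= 1.
Proof.
intros hT h0.
assert (hp := PI_RGT_0).
assert (hdec := theta_decr t0 T hT h0).
(* The levels are equally spaced in the coordinate [(x - 2 phi) / (2 pi)]. *)
set (xT := (theta T - 2 * phi) / (2 * PI)).
set (x0 := (theta t0 - 2 * phi) / (2 * PI)).
assert (ET : theta T = 2 * phi + 2 * PI * xT) by (unfold xT; field; lra).
assert (E0 : theta t0 = 2 * phi + 2 * PI * x0) by (unfold x0; field; lra).
assert (hx : xT < x0) by nra.
assert (Hneg : forall t, t0 < t -> theta1 t < 0).
{ intros t ht; generalize (theta1_decr t0 t ltac:(lra)); lra. }
destruct (list_of_roots phi (fun t => t0 < t <=
  T) (Zrange (Zceil xT) (Zceil x0))) as [l [h1 [h2 h3]]].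
{ intros s t hs ht; apply theta_inj_decr; try lra; now apply Hneg. }
{ apply NoDup_Zrange. }
destruct (Zceil_bounds xT) as [a1 a2]. destruct (Zceil_bounds x0) as [b1 b2].
exists l; split; [easy|split].
- intros t; rewrite h2; split; [intros [ht [k [_ Hk]]]; split; [easy|now exists k]|].
  intros [ht [k Hk]]; split; [easy|exists k; split; [|easy]].
  apply in_Zrange.
  assert (B1 : theta t < theta t0) by (apply theta_decr; lra).
  assert (B2 : theta T <= theta t).
  { destruct (Req_dec t T) as [->|]; [lra|]. left; apply theta_decr; [lra|now apply Hneg]. }
  rewrite Hk in B1, B2; unfold level in B1, B2; rewrite E0 in B1; rewrite ET in B2.
  assert (C1 : IZR k < x0) by nra. assert (C2 : xT <= IZR k) by nra.
  split.
  + assert (IZR (Zceil xT) < IZR (k + 1)) by (rewrite plus_IZR; lra).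
    apply lt_IZR in H; lia.
  + apply lt_IZR; lra.
- rewrite h3, length_Zrange.
  + assert (Hle : (Zceil xT <= Zceil x0)%Z).
    { assert (IZR (Zceil xT) < IZR (Zceil x0 + 1)) by (rewrite plus_IZR; lra).
      apply lt_IZR in H; lia. }
    rewrite INR_IZR_INZ, Z2Nat.id, minus_IZR by lia.
    replace ((theta t0 - theta T) / (2 * PI)) with (x0 - xT) by (unfold x0, xT; field; lra).
    apply Rabs_le; lra.
  + intros k Hk%in_Zrange.
    assert (K1 : xT <= IZR k) by (apply Rle_trans with (1 := a1); apply IZR_le; lia).
    assert (K2 : IZR k < x0).
    { assert (IZR k <= IZR (Zceil x0 - 1)) by (apply IZR_le; lia). rewrite minus_IZR in H; lra. }
    assert (L1 : theta T <= level phi k) by (rewrite ET; unfold level; nra).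
    assert (L2 : level phi k < theta t0) by (rewrite E0; unfold level; nra).
    destruct (IVT_gen theta t0 T (level phi k)) as [t [Ht Et]].
    * intros x; apply continuity_pt_filterlim, theta_continuous.
    * rewrite Rmin_right, Rmax_left by lra; lra.
    * rewrite Rmin_left, Rmax_right in Ht by lra.
      exists t; split; [|easy]. split; [|lra].
      destruct (proj1 Ht) as [|<-]; [easy|lra].
Qed.

Lemma number_of_zeros_tail (phi : R) (t0 T : R) (n0 n : nat) : 0 < t0 < T -> theta1 t0 < 0 ->
  number_of_zeros (root_function phi) t0 n0 -> number_of_zeros (root_function phi) T n ->
  Rabs (INR n - INR n0 - (theta t0 - theta T) / (2 * PI)) <= 1.
Proof.
intros hT h0 [l0 [[z1 z2] <-]] hn.
destruct (tail_count phi t0 T hT h0) as [l [n1 [i1 Hl]]].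
assert (Hneg : forall t, t0 < t -> theta1 t < 0).
{ intros t ht; generalize (theta1_decr t0 t ltac:(lra)); lra. }
rewrite (number_of_zeros_unique _ _ _ (length (l0 ++ l)) hn).
- rewrite length_app, plus_INR.
  now replace (INR (length l0) + INR (length l) - INR (length l0)) with (INR (length l)) by ring.
- exists (l0 ++ l); split; [split|easy].
  + intros t [Ht%z1|Ht%i1]%in_app_iff; lra.
  + intros t ht. rewrite count_occ_app.
    destruct (Rle_or_lt t t0) as [h|h].
    * rewrite (proj1 (count_occ_not_In Req_dec_T l t)), Nat.add_0_r; [apply z2; lra|].
      rewrite i1; lra.
    * rewrite (proj1 (count_occ_not_In Req_dec_T l0 t)); [|intros Ht%z1; lra].
      destruct (classic (exists k, theta t = level phi k)) as [Hk|N].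
      -- rewrite (proj1 (NoDup_count_occ' Req_dec_T l) n1 t) by (apply i1; split; [lra|easy]).
         apply root_order_1; [easy|]. generalize (Hneg t h); lra.
      -- rewrite (proj1 (count_occ_not_In Req_dec_T l t)) by (rewrite i1; tauto).
         now apply root_order_0.
Qed.

(** All bounded terms are absorbed in a constant, which is at most its product with
    [ln T] once [T > e]. *)
Lemma counting_asymptotic (phi : R) : exists N : R -> nat,
  (forall T : R, 0 < T -> number_of_zeros (root_function phi) T (N T)) /\
  exists K : R, Rbar_locally p_infty (fun T : R =>
    Rabs (INR (N T) - T / (2 * PI) * ln (T / (2 * PI * exp 1))) <= K * ln T).
Proof.
assert (H : forall T, exists n, 0 < T -> number_of_zeros (root_function phi) T n).
{ intros T; destruct (Rlt_dec 0 T) as [h|h].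
  - destruct (number_of_zeros_exists phi T h) as [n Hn]; now exists n.
  - exists O; easy. }
destruct (choice _ H) as [N HN].
exists N; split; [exact HN|].
destruct exists_theta1_neg as [t0 [h0 h1]].
assert (hp := PI2_3_2).
exists (INR (N t0) + 1 + (Rabs (theta t0) + PI) / (2 * PI)), (Rmax (exp 1) t0).
intros T hT.
assert (hT1 : exp 1 < T) by (apply Rle_lt_trans with (2 := hT), Rmax_l).
assert (hT2 : t0 < T) by (apply Rle_lt_trans with (2 := hT), Rmax_r).
assert (he : 2 < exp 1) by (generalize (exp_ineq1 1); lra).
assert (hl : 1 < ln T) by (rewrite <- (ln_exp 1); apply ln_increasing; [apply exp_pos|easy]).
set (K := INR (N t0) + 1 + (Rabs (theta t0) + PI) / (2 * PI)).
assert (hK : 0 <= K).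
{ unfold K; generalize (pos_INR (N t0)); intros.
  assert (0 <= (Rabs (theta t0) + PI) / (2 * PI)); [|lra].
  apply Rdiv_le_0_compat; [generalize (Rabs_pos (theta t0)); lra|lra]. }
apply Rle_trans with K; [|nra].
generalize (number_of_zeros_tail phi t0 T (N t0) (N T) ltac:(lra) h1 (HN t0 ltac:(lra)) (HN T
  ltac:(lra))).
generalize (theta_asymptotic T ltac:(lra)).
set (A := T * ln (T / (2 * PI * exp 1))); intros H1 H2.
replace (T / (2 * PI) * ln (T / (2 * PI * exp 1))) with (A / (2 * PI)) by (unfold A; field; lra).
replace (INR (N T) - A / (2 * PI)) with
  ((INR (N T) - INR (N t0) - (theta t0 - theta T) / (2 * PI)) + (INR (N t0) + (theta t0 - (theta T
    + A)) / (2 * PI)))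
  by (field; lra).
eapply Rle_trans; [apply Rabs_triang|].
assert (Rabs (INR (N t0) + (theta t0 - (theta T + A)) / (2 * PI)) <=
  INR (N t0) + (Rabs (theta t0) + PI) / (2 * PI)).
{ eapply Rle_trans; [apply Rabs_triang|].
  rewrite (Rabs_pos_eq (INR _)) by apply pos_INR.
  apply Rplus_le_compat_l.
  unfold Rdiv; rewrite Rabs_mult, (Rabs_pos_eq (/ _)) by (left; apply Rinv_0_lt_compat; lra).
  apply Rmult_le_compat_r; [left; apply Rinv_0_lt_compat; lra|].
  eapply Rle_trans; [apply Rabs_triang|]. rewrite Rabs_Ropp; lra. }
unfold K; lra.
Qed.

(** * Complex power series *)

Local Notation Cseries a l := (@is_series C_AbsRing C_NormedModule a l).

Local Notation Cpseries a z l := (@is_pseries C_AbsRing C_NormedModule a z l).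

Lemma Cseries_eps (a : nat -> C) (l : C) :
  Cseries a l <-> forall eps : posreal, eventually (fun n => Cmod (@sum_n C_AbelianMonoid a n -
    l)%C < eps).
Proof. exact (filterlim_locally_ball_norm (K := C_AbsRing) (U := C_NormedModule) (@sum_n
  C_AbelianMonoid a) l). Qed.

Lemma pow_n_Cpow (z : C) (n : nat) : @pow_n C_Ring z n = (z ^ n)%C.
Proof. induction n as [|n IH]; simpl; [easy|now rewrite IH]. Qed.

Lemma sum_n_Re (a : nat -> C) (n : nat) : Re (@sum_n C_AbelianMonoid a n) = sum_n (fun k => Re (a
  k)) n.
Proof.
induction n as [|n IH]; [now rewrite !sum_O|].
rewrite !sum_Sn, <- IH; reflexivity.
Qed.

Lemma sum_n_Cconj (a : nat -> C) (n : nat) :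
  @sum_n C_AbelianMonoid (fun k => Cconj (a k)) n = Cconj (@sum_n C_AbelianMonoid a n).
Proof.
induction n as [|n IH]; [now rewrite !sum_O|].
rewrite !sum_Sn, IH. unfold plus, Cconj; simpl; unfold Cplus; simpl. f_equal; ring.
Qed.

Lemma Cseries_conj (a : nat -> C) (l : C) :
  Cseries a l -> Cseries (fun k => Cconj (a k)) (Cconj l).
Proof.
rewrite !Cseries_eps; intros H eps; generalize (H eps); apply filter_imp; intros n.
rewrite sum_n_Cconj, <- (Cmod_conj (_ - l)).
now rewrite Cminus_conj.
Qed.

Lemma Cseries_le (a : nat -> C) (l c : C) (B : R) : Cseries a l ->
  eventually (fun n => Cmod (@sum_n C_AbelianMonoid a n - c)%C <= B) -> Cmod (l - c) <= B.
Proof.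
intros H HB; apply Rnot_lt_le; intros h.
assert (he : 0 < Cmod (l - c) - B) by lra.
rewrite Cseries_eps in H.
destruct (filter_and _ _ (H (mkposreal _ he)) HB) as [n Hn].
destruct (Hn n (Nat.le_refl n)) as [H1 H2]; simpl in H1.
set (S := @sum_n C_AbelianMonoid a n) in *.
generalize (Cmod_triangle (l - S) (S - c)).
replace (l - S + (S - c))%C with (l - c)%C by ring.
replace (l - S)%C with (- (S - l))%C by ring; rewrite Cmod_opp; lra.
Qed.

Lemma pseries_terms_bounded (a : nat -> C) (z l : C) :
  Cpseries a z l -> exists M, forall n, Cmod (a n) * Cmod z ^ n <= M.
Proof.
intros H.
destruct (filterlim_bounded (K := C_AbsRing) (V := C_NormedModule) _ (ex_intro _ l H)) as [M HM].
change (forall n, Cmod (@sum_n C_AbelianMonoid (fun k => @pow_n C_Ring z k * a k)%C n) <= M) in HM.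
assert (HM' : forall n, Cmod (@pow_n C_Ring z n * a n)%C <= M + M).
{ intros [|n].
  - generalize (HM O) (Cmod_ge_0 (@pow_n C_Ring z 0 * a O)%C); rewrite sum_O; lra.
  - generalize (HM (S n)) (HM n); rewrite sum_Sn; intros h1 h2.
    set (s := @sum_n C_AbelianMonoid _ n) in *.
    change (Cmod (s + @pow_n C_Ring z (S n) * a (S n))%C <= M) in h1.
    set (x := (_ * a (S n))%C) in *.
    replace x with ((s + x) + - s)%C by ring.
    eapply Rle_trans; [apply Cmod_triangle|]. rewrite Cmod_opp; lra. }
exists (M + M); intros n.
rewrite <- Cmod_pow, <- Cmod_mult, Cmult_comm, <- pow_n_Cpow; apply HM'.
Qed.

(** If the terms are bounded by [M] on the circle of radius [r], then at [|z| <= r/2] the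
    terms after the [m]-th are dominated by [M q^k] with [q = |z| / r <= 1/2], and the
    geometric tail is at most [2 M q^(m+1)]. *)
Lemma pseries_first_term (a : nat -> C) (z l : C) (m : nat) (M r : R) :
  0 < r -> (forall n, Cmod (a n) * r ^ n <= M) -> (forall k, (k < m)%nat -> a k = 0%C) ->
  Cmod z <= r / 2 -> Cpseries a z l ->
  Cmod (l - a m * z ^ m) <= 2 * M * (Cmod z / r) ^ S m.
Proof.
intros hr hM ha hz H.
set (q := Cmod z / r).
assert (hq : 0 <= q <= / 2).
{ unfold q; split; [apply Rdiv_le_0_compat; [apply Cmod_ge_0|easy]|].
  apply (Rmult_le_reg_r r); [easy|]. unfold Rdiv; rewrite Rmult_assoc, Rinv_l; lra. }
assert (hM0 : 0 <= M).
{ apply Rle_trans with (2 := hM O). simpl; rewrite Rmult_1_r; apply Cmod_ge_0. }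
set (t := fun k => (@pow_n C_Ring z k * a k)%C).
assert (ht : forall k, Cmod (t k) <= M * q ^ k).
{ intros k; unfold t; rewrite pow_n_Cpow, Cmod_mult, Cmod_pow.
  replace (Cmod z) with (q * r) by (unfold q; field; lra).
  rewrite Rpow_mult_distr. generalize (hM k) (pow_le q k (proj1 hq)). nra. }
change (Cseries t l) in H.
apply Cseries_le with (1 := H).
assert (t0 : forall k, (k < m)%nat -> t k = RtoC 0).
{ intros k hk; unfold t; rewrite ha by easy; apply Cmult_0_r. }
assert (tm : t m = (a m * z ^ m)%C) by (unfold t; rewrite pow_n_Cpow; apply Cmult_comm).
assert (h0 : forall k, (k < m)%nat -> @sum_n C_AbelianMonoid t k = RtoC 0).
{ intros k hk; induction k as [|k IH].
  - rewrite sum_O; now apply t0.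
  - rewrite sum_Sn, IH, t0 by lia. apply Cplus_0_l. }
assert (h1 : @sum_n C_AbelianMonoid t m = (a m * z ^ m)%C).
{ rewrite <- tm; destruct m as [|m]; [now rewrite sum_O|].
  rewrite sum_Sn, h0 by lia. apply Cplus_0_l. }
assert (h2 : forall j, Cmod (@sum_n C_AbelianMonoid t (m + j) - a m * z ^ m)%C <=
  2 * M * (q ^ S m - q ^ (S m + j))).
{ induction j as [|j IH].
  - rewrite !Nat.add_0_r, h1.
    replace (_ - _)%C with (RtoC 0) by ring. rewrite Cmod_0; lra.
  - rewrite !Nat.add_succ_r, sum_Sn.
    set (s := @sum_n C_AbelianMonoid t (m + j)) in *.
    change (Cmod (s + t (S (m + j)) - a m * z ^ m)%C <= 2 * M * (q ^ S m - q ^ S (S m + j))).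
    replace (s + t (S (m + j)) - a m * z ^ m)%C with ((s - a m * z ^ m) + t (S (m + j)))%C by ring.
    eapply Rle_trans; [apply Cmod_triangle|].
    generalize (ht (S (m + j))).
    replace (S m + j)%nat with (S (m + j)) in * by lia.
    rewrite <- (tech_pow_Rmult q (S (m + j))).
    generalize (pow_le q (S (m + j)) (proj1 hq)); intros.
    assert (M * (q * q ^ S (m + j)) <= M * (/ 2 * q ^ S (m + j))).
    { apply Rmult_le_compat_l; [easy|]. apply Rmult_le_compat_r; lra. }
    lra. }
exists m; intros n hn.
replace n with (m + (n - m))%nat by lia.
eapply Rle_trans; [apply h2|].
apply Rmult_le_compat_l; [lra|].
generalize (pow_le q (S m + (n - m)) (proj1 hq)); lra.
Qed.

Lemma pseries_unique (a : nat -> C) (z l l' : C) : Cpseries a z l -> Cpseries a z l' -> l = l'.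
Proof.
intros H H'.
assert (E : forall eps, 0 < eps -> Cmod (l - l') <= eps).
{ intros e he; apply Cseries_le with (1 := H).
  unfold is_pseries in H'; rewrite Cseries_eps in H'.
  generalize (H' (mkposreal _ he)); apply filter_imp; intros n; simpl; intros; lra. }
assert (E0 : Cmod (l - l') = 0).
{ generalize (Cmod_ge_0 (l - l')); intros h. apply Rle_antisym; [|easy].
  apply le_epsilon; intros e he; rewrite Rplus_0_l; now apply E. }
apply Cmod_eq_0 in E0.
replace l with ((l - l') + l')%C by ring; rewrite E0; ring.
Qed.

(** * Zeros of analytic functions *)

Definition locally_zero (f : C -> C) (z0 : C) : Prop :=
  exists r, 0 < r /\ forall z, Cmod (z - z0) < r -> f z = 0%C.

Lemma locally_zero_self (f : C -> C) (z0 : C) : locally_zero f z0 -> f z0 = 0%C.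
Proof.
intros [r [hr H]]; apply H.
replace (z0 - z0)%C with (RtoC 0) by ring. now rewrite Cmod_0.
Qed.

Lemma analytic_at_disc (f : C -> C) (z0 : C) : analytic_at f z0 ->
  exists (a : nat -> C) (r : R), 0 < r /\ forall z, Cmod (z - z0) < r ->
    Cpseries a (z - z0)%C (f z).
Proof.
intros [a [e H]]; exists a, e; split; [apply cond_pos|].
intros z hz; apply H.
generalize (Rmax_Cmod (z - z0)%C); intros hm.
split.
- apply Rle_lt_trans with (2 := hz), Rle_trans with (2 := hm), Rmax_l.
- apply Rle_lt_trans with (2 := hz), Rle_trans with (2 := hm), Rmax_r.
Qed.

Lemma pseries_disc_bounds (a : nat -> C) (f : C -> C) (z0 : C) (r : R) : 0 < r ->
  (forall z, Cmod (z - z0) < r -> Cpseries a (z - z0)%C (f z)) ->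
  exists M, 0 <= M /\ forall n, Cmod (a n) * (r / 2) ^ n <= M.
Proof.
intros hr H.
assert (E : Cmod (z0 + RtoC (r / 2) - z0)%C = r / 2).
{ replace (z0 + RtoC (r / 2) - z0)%C with (RtoC (r / 2)) by ring. rewrite Cmod_R, Rabs_pos_eq;
    lra. }
destruct (pseries_terms_bounded _ _ _ (H (z0 + RtoC (r / 2))%C ltac:(lra))) as [M HM].
rewrite E in HM; exists M; split; [|easy].
apply Rle_trans with (2 := HM O). simpl; rewrite Rmult_1_r; apply Cmod_ge_0.
Qed.

Lemma analytic_locally_bounded (f : C -> C) (z0 : C) : analytic_at f z0 ->
  exists r B, 0 < r /\ forall z, Cmod (z - z0) < r -> Cmod (f z) <= B.
Proof.
intros [a [r [hr H]]]%analytic_at_disc.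
destruct (pseries_disc_bounds a f z0 r hr H) as [M [hM0 hM]].
exists (r / 4), (Cmod (a O) + 2 * M); split; [lra|].
intros z hz.
generalize (pseries_first_term a (z - z0)%C (f z) O M (r / 2) ltac:(lra) hM
  ltac:(intros; lia) ltac:(lra) (H z ltac:(lra))).
set (q := Cmod (z - z0) / (r / 2)).
assert (hq : q <= 1).
{ unfold q; apply (Rmult_le_reg_r (r / 2)); [lra|]. unfold Rdiv at 1; rewrite Rmult_assoc, Rinv_l;
    lra. }
rewrite pow_1; simpl (_ ^ 0)%C; rewrite Cmult_1_r; intros h.
replace (f z) with ((f z - a O) + a O)%C by ring.
eapply Rle_trans; [apply Cmod_triangle|]. nra.
Qed.

(** If the coefficients before the [m]-th vanish, [pseries_first_term] at a zero [z] of [f]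
    gives [|a m| = O(|z - z0|)]; zeros arbitrarily close to [z0] force [a m = 0]. *)
Lemma analytic_isolated_zeros (f : C -> C) (z0 : C) : analytic_at f z0 ->
  (forall eps, 0 < eps -> exists z, 0 < Cmod (z - z0) < eps /\ f z = 0%C) ->
  locally_zero f z0.
Proof.
intros [a [r [hr H]]]%analytic_at_disc Hz.
destruct (pseries_disc_bounds a f z0 r hr H) as [M [hM0 hM]].
assert (ha : forall m, a m = RtoC 0).
{ intros m; induction m as [m IH] using lt_wf_ind.
  apply Cmod_eq_0, Rle_antisym; [|apply Cmod_ge_0].
  apply le_epsilon; intros e he; rewrite Rplus_0_l.
  assert (hp : 0 < (r / 2) ^ S m) by (apply pow_lt; lra).
  set (c := 2 * M / (r / 2) ^ S m).
  assert (hc : 0 <= c) by (apply Rdiv_le_0_compat; lra).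
  destruct (Hz (Rmin (r / 4) (e / (c + 1)))) as [z [[h1 h2] h3]].
  { apply Rmin_pos; [lra|]. apply Rdiv_lt_0_compat; lra. }
  assert (h4 : Cmod (z - z0) < r / 4) by (apply Rlt_le_trans with (1 := h2), Rmin_l).
  assert (h5 : Cmod (z - z0) < e / (c + 1)) by (apply Rlt_le_trans with (1 := h2), Rmin_r).
  generalize (pseries_first_term a (z - z0)%C (f z) m M (r / 2) ltac:(lra) hM IH ltac:(lra) (H z
    ltac:(lra))).
  rewrite h3.
  replace (0 - a m * (z - z0) ^ m)%C with (- (a m * (z - z0) ^ m))%C by ring.
  rewrite Cmod_opp, Cmod_mult, Cmod_pow.
  set (x := Cmod (z - z0)) in *.
  assert (hx : 0 < x ^ m) by now apply pow_lt.
  replace (2 * M * (x / (r / 2)) ^ S m) with (c * x * x ^ m).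
  2: { unfold c, Rdiv at 3; rewrite Rpow_mult_distr, pow_inv; simpl (x ^ S m); field; lra. }
  intros h6; apply Rmult_le_reg_r in h6; [|easy].
  apply Rle_trans with (1 := h6).
  apply Rle_trans with (c * (e / (c + 1))); [apply Rmult_le_compat_l; lra|].
  apply (Rmult_le_reg_r (c + 1)); [lra|].
  replace (c * (e / (c + 1)) * (c + 1)) with (c * e) by (field; lra). nra. }
exists r; split; [easy|]; intros z hz.
apply (pseries_unique a (z - z0)%C); [now apply H|].
unfold is_pseries; rewrite Cseries_eps; intros eps; exists O; intros n _.
assert (E : @sum_n C_AbelianMonoid (fun k => @scal C_Ring C_ModuleSpace (@pow_n C_Ring (z - z0)%C
  k) (a k)) n = RtoC 0).
{ induction n as [|n IHn].
  - rewrite sum_O, ha. apply (@scal_zero_r C_Ring C_ModuleSpace).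
  - rewrite sum_Sn, IHn, ha, (@scal_zero_r C_Ring C_ModuleSpace).
    apply (@plus_zero_r C_AbelianMonoid). }
change (Cmod (@sum_n C_AbelianMonoid (fun k => @scal C_Ring C_ModuleSpace (@pow_n C_Ring (z -
  z0)%C k) (a k)) n - 0)%C < eps).
rewrite E. replace (0 - 0)%C with (RtoC 0) by ring. rewrite Cmod_0; apply cond_pos.
Qed.

Lemma locally_zero_near (f : C -> C) (z0 : C) : locally_zero f z0 ->
  exists r, 0 < r /\ forall z, Cmod (z - z0) < r -> locally_zero f z.
Proof.
intros [r [hr H]]; exists (r / 2); split; [lra|]; intros z hz.
exists (r / 2); split; [lra|]; intros y hy; apply H.
replace (y - z0)%C with ((y - z) + (z - z0))%C by ring.
eapply Rle_lt_trans; [apply Cmod_triangle|]. lra.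
Qed.

(** The set of parameters up to which [f] is locally zero is open, and it is closed by
    [analytic_isolated_zeros]; analyticity is needed only at the points of the segment,
    which lets it avoid the singularities. *)
Lemma identity_along_segment (f : C -> C) (p q : C) : p <> q ->
  (forall u, 0 <= u <= 1 -> analytic_at f (p + RtoC u * (q - p))%C) ->
  locally_zero f p -> f q = 0%C.
Proof.
intros hpq Ha H0.
pose (g := fun u : R => (p + RtoC u * (q - p))%C).
assert (hl : 0 < Cmod (q - p)).
{ apply Cmod_gt_0; intros E; apply hpq. replace q with ((q - p) + p)%C by ring. rewrite E; ring. }
assert (hg : forall u v, Cmod (g u - g v)%C = Rabs (u - v) * Cmod (q - p)).
{ intros u v; unfold g; rewrite <- Cmod_R, <- Cmod_mult, RtoC_minus; f_equal; ring. }
pose (E := fun u => 0 <= u <= 1 /\ forall v, 0 <= v <= u -> locally_zero f (g v)).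
assert (g0 : g 0 = p) by (unfold g; ring).
assert (E0 : E 0).
{ split; [lra|]. intros v hv; replace v with 0 by lra; now rewrite g0. }
destruct (completeness E) as [s [Hs1 Hs2]].
{ exists 1; intros u [hu _]; lra. } { now exists 0. }
assert (hs0 : 0 <= s) by now apply Hs1.
assert (hs1 : s <= 1) by (apply Hs2; intros u [hu _]; lra).
assert (Hlt : forall v, 0 <= v < s -> locally_zero f (g v)).
{ intros v hv. apply NNPP; intros N.
  assert (s <= v); [|lra].
  apply Hs2; intros u [hu Hu]. apply Rnot_lt_le; intros h; apply N, Hu; lra. }
assert (Hs : locally_zero f (g s)).
{ destruct (Req_dec s 0) as [->|n]; [now rewrite g0|].
  apply analytic_isolated_zeros; [apply Ha; lra|].
  intros e he.
  set (d := Rmin s (e / Cmod (q - p)) / 2).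
  assert (hd : 0 < Rmin s (e / Cmod (q - p))).
  { apply Rmin_pos; [lra|]. now apply Rdiv_lt_0_compat. }
  assert (hd1 : d < s) by (unfold d; generalize (Rmin_l s (e / Cmod (q - p))); lra).
  assert (hd2 : d < e / Cmod (q - p)) by (unfold d; generalize (Rmin_r s (e / Cmod (q - p))); lra).
  assert (hd0 : 0 < d) by (unfold d; lra).
  exists (g (s - d)); split.
  - rewrite hg. replace (s - d - s) with (- d) by ring. rewrite Rabs_Ropp, Rabs_pos_eq by lra.
    split; [now apply Rmult_lt_0_compat|].
    apply (Rmult_lt_compat_r (Cmod (q - p))) in hd2; [|easy].
    now replace (e / Cmod (q - p) * Cmod (q - p)) with e in hd2 by (field; lra).
  - apply locally_zero_self, Hlt; lra. }
assert (Es : s = 1).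
{ apply Rle_antisym; [easy|]. apply Rnot_lt_le; intros h.
  destruct (locally_zero_near f (g s) Hs) as [r [hr Hr]].
  set (d := Rmin (1 - s) (r / Cmod (q - p)) / 2).
  assert (hd : 0 < Rmin (1 - s) (r / Cmod (q - p))).
  { apply Rmin_pos; [lra|]. now apply Rdiv_lt_0_compat. }
  assert (hd1 : d < 1 - s) by (unfold d; generalize (Rmin_l (1 - s) (r / Cmod (q - p))); lra).
  assert (hd2 : d < r / Cmod (q - p)) by (unfold d;
    generalize (Rmin_r (1 - s) (r / Cmod (q - p))); lra).
  assert (hd0 : 0 < d) by (unfold d; lra).
  assert (s + d <= s); [|lra].
  apply Hs1; split; [lra|]. intros v hv.
  destruct (Rlt_or_le v s) as [hv'|hv']; [apply Hlt; lra|].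
  apply Hr; rewrite hg, Rabs_pos_eq by lra.
  apply Rle_lt_trans with (d * Cmod (q - p)); [apply Rmult_le_compat_r; lra|].
  apply (Rmult_lt_compat_r (Cmod (q - p))) in hd2; [|easy].
  now replace (r / Cmod (q - p) * Cmod (q - p)) with r in hd2 by (field; lra). }
rewrite Es in Hs.
replace q with (g 1) by (unfold g; ring). now apply locally_zero_self.
Qed.

(** * Zeta near 1 *)

Lemma sum_n_le_upto (u v : nat -> R) (n : nat) :
  (forall k, (k <= n)%nat -> u k <= v k) -> sum_n u n <= sum_n v n.
Proof.
induction n as [|n IH]; intros H.
- rewrite !sum_O; now apply H.
- rewrite !sum_Sn; apply Rplus_le_compat; [apply IH; intros; apply H; lia|apply H; lia].
Qed.

Lemma harmonic_ge_ln (n : nat) : ln (INR n + 2) <= sum_n (fun k => / INR (S k)) n.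
Proof.
induction n as [|n IH].
- rewrite sum_O; simpl. eapply Rle_trans; [apply ln_le_sub_1; lra|lra].
- rewrite sum_Sn.
  match goal with |- _ <= plus ?a ?b => change (plus a b) with (a + b) end.
  generalize (pos_INR n); rewrite !S_INR; intros hn.
  assert (E : ln ((INR n + 1 + 2) / (INR n + 2)) <= / (INR n + 1 + 1)).
  { eapply Rle_trans; [apply ln_le_sub_1; apply Rdiv_lt_0_compat; lra|]. right; field; lra. }
  rewrite ln_div in E by lra. lra.
Qed.

(** At [s = 1 + 1/L] with [L = ln (N + 2)] the first [N + 1] terms of the Dirichlet series lose
    at most a factor [e] against the harmonic ones, whose sum is at least [L]. *)
Lemma zeta_unbounded_at_1 (zeta : C -> C) (B d : R) : is_riemann_zeta zeta -> 0 < d ->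
  exists s, 1 < s < 1 + d /\ B < Cmod (zeta (RtoC s)).
Proof.
intros [_ Hz] hd.
set (X := Rmax (/ d + 1) (exp 1 * (Rabs B + 1))).
assert (hid : 0 < / d) by now apply Rinv_0_lt_compat.
assert (hX1 : / d + 1 <= X) by apply Rmax_l.
assert (hX2 : exp 1 * (Rabs B + 1) <= X) by apply Rmax_r.
destruct (nfloor_ex (exp X)) as [N HN]; [left; apply exp_pos|].
assert (hL : X < ln (INR N + 2)).
{ rewrite <- (ln_exp X) at 1. apply ln_increasing; [apply exp_pos|lra]. }
set (L := ln (INR N + 2)) in *.
assert (hiL : / L < d).
{ rewrite <- (Rinv_inv d). apply Rinv_lt_contravar; [|lra]. apply Rmult_lt_0_compat; lra. }
assert (hiL0 : 0 < / L) by (apply Rinv_0_lt_compat; lra).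
exists (1 + / L); split; [lra|].
set (s := 1 + / L).
generalize (Hz (RtoC s) ltac:(simpl; unfold s; lra)); intros Hs.
set (a := fun n : nat => Rcpow (INR (S n)) (- RtoC s)).
assert (Ea : forall n, Re (a n) = exp (- (s * ln (INR (S n))))).
{ intros n; unfold a, Rcpow, Cexp.
  replace (Im (- RtoC s * RtoC (ln (INR (S n))))%C) with 0 by (simpl; ring).
  replace (Re (- RtoC s * RtoC (ln (INR (S n))))%C) with (- (s * ln (INR (S n)))) by (simpl; ring).
  simpl (fst _); rewrite cos_0; apply Rmult_1_r. }
assert (Hpart : sum_n (fun k => Re (a k)) N <= Cmod (zeta (RtoC s))).
{ apply Rle_trans with (Rabs (Re (zeta (RtoC s)))); [|apply re_le_Cmod].
  apply Rle_trans with (2 := Rle_abs _).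
  apply (is_lim_seq_incr_compare (sum_n (fun k => Re (a k)))).
  - apply is_lim_seq_spec; intros e.
    generalize (proj1 (Cseries_eps _ _) Hs e); apply filter_imp; intros n hn.
    rewrite <- sum_n_Re.
    apply Rle_lt_trans with (2 := hn), Rle_trans with (2 := re_le_Cmod _).
    right; reflexivity.
  - intros n; rewrite sum_Sn.
    match goal with |- _ <= plus ?a ?b => change (plus a b) with (a + b) end.
    rewrite Ea; generalize (exp_pos (- (s * ln (INR (S (S n)))))); lra. }
apply Rlt_le_trans with (2 := Hpart).
apply Rlt_le_trans with (exp (- 1) * sum_n (fun k => / INR (S k)) N).
- apply Rlt_le_trans with (exp (- 1) * L).
  2: { apply Rmult_le_compat_l; [left; apply exp_pos|apply harmonic_ge_ln]. }
  apply Rlt_le_trans with (exp (- 1) * (exp 1 * (Rabs B + 1))).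
  + rewrite <- Rmult_assoc, <- exp_plus. replace (-1 + 1) with 0
      by ring. rewrite exp_0. generalize (Rle_abs B); lra.
  + apply Rmult_le_compat_l; [left; apply exp_pos|lra].
- rewrite <- (sum_n_mult_l (K := R_Ring) (exp (- 1))).

  assert (Hk : forall k, (k <= N)%nat -> exp (- 1) * / INR (S k) <= Re (a k)).
  { intros k hk; rewrite Ea.
    assert (h0 : 0 < INR (S k)) by (apply lt_0_INR; lia).
    rewrite <- (exp_ln (INR (S k)) h0) at 1. rewrite <- exp_Ropp, <- exp_plus.
    assert (hk' : ln (INR (S k)) <= L).
    { apply ln_le; [easy|]. rewrite S_INR; generalize (le_INR _ _ hk); lra. }
    assert (- 1 + - ln (INR (S k)) <= - (s * ln (INR (S k)))).
    { unfold s. assert (/ L * ln (INR (S k)) <= / L * L) by (apply Rmult_le_compat_l; lra).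
      rewrite Rinv_l in H by lra. lra. }
    destruct (Req_dec (- 1 + - ln (INR (S k))) (- (s * ln (INR (S k))))) as [->|]; [lra|].
    left; apply exp_increasing; lra. }
  now apply sum_n_le_upto.
Qed.

(** * Values of zeta on a line through the origin *)

(** On the critical line [1 - conj s = s], so that this is [2 i] times the imaginary part of
    [e zeta s]. *)
Definition reflection_defect (e : C) (zeta : C -> C) (s : C) : C :=
  (e * zeta s - Cconj (e * zeta (1 - Cconj s)))%C.

(** The map [s -> conj (zeta (1 - conj s))] is analytic because it conjugates twice; its
    coefficients at [s0] are [(- 1)^n] times the conjugates of those of zeta at
    [1 - conj s0]. *)
Lemma reflection_defect_analytic (e : C) (zeta : C -> C) (s0 : C) :
  (forall s : C, s <> 1%C -> analytic_at zeta s) -> s0 <> 0%C -> s0 <> 1%C ->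
  analytic_at (reflection_defect e zeta) s0.
Proof.
intros Ha h0 h1.
assert (h2 : (1 - Cconj s0)%C <> 1%C).
{ intros E; apply h0; destruct s0 as [x y].
  generalize (f_equal fst E) (f_equal snd E); simpl; intros E1 E2.
  unfold RtoC; f_equal; lra. }
destruct (analytic_at_disc zeta s0 (Ha s0 h1)) as [a [r [hr Hr]]].
destruct (analytic_at_disc zeta _ (Ha _ h2)) as [b [r' [hr' Hr']]].
exists (fun n => (e * a n - Cconj e * ((- 1) ^ n * Cconj (b n)))%C).
assert (hd : 0 < Rmin r r' / 2) by (generalize (Rmin_pos r r' hr hr'); lra).
exists (mkposreal _ hd); intros z [hz1 hz2].
assert (hz : Cmod (z - s0) < Rmin r r').
{ eapply Rle_lt_trans; [apply Cmod_2Rmax|].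
  change (Rabs (fst (z - s0)%C) < Rmin r r' / 2) in hz1.
  change (Rabs (snd (z - s0)%C) < Rmin r r' / 2) in hz2.
  set (m := Rmin r r') in *.
  assert (Rmax (Rabs (fst (z - s0)%C)) (Rabs (snd (z - s0)%C)) < m / 2) by now apply Rmax_lub_lt.
  assert (sqrt 2 <= 2).
  { rewrite <- (sqrt_pow2 2) at 2 by lra. apply sqrt_le_1_alt; lra. }
  generalize (sqrt_pos 2) (Rabs_pos (fst (z - s0)%C)) (Rmax_l (Rabs (fst (z - s0)%C)) (Rabs (snd
    (z - s0)%C))).
  nra. }
generalize (Hr z (Rlt_le_trans _ _ _ hz (Rmin_l _ _))); intros S1.
assert (Ez : (1 - Cconj z - (1 - Cconj s0))%C = (- Cconj (z - s0))%C).
{ unfold Cconj, Cminus, Cplus, Copp, RtoC; simpl; f_equal; ring. }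
assert (hz' : Cmod (1 - Cconj z - (1 - Cconj s0)) < r').
{ rewrite Ez, Cmod_opp, Cmod_conj. apply Rlt_le_trans with (1 := hz), Rmin_r. }
generalize (Hr' (1 - Cconj z)%C hz'); intros S2.
rewrite Ez in S2.
unfold is_pseries in *; apply Cseries_conj in S2.
apply (@is_series_scal C_AbsRing C_NormedModule (Cconj e)) in S2.
apply (@is_series_scal C_AbsRing C_NormedModule e) in S1.
generalize (is_series_minus _ _ _ _ S1 S2).
unfold reflection_defect; rewrite Cmult_conj.
apply is_series_ext.
intros n.
change ((e * (@pow_n C_Ring (z - s0)%C n * a n)
  - Cconj e * Cconj (@pow_n C_Ring (- Cconj (z - s0))%C n * b n))%C =
  (@pow_n C_Ring (z - s0) n * (e * a n - Cconj e * ((- 1) ^ n * Cconj (b n))))%C).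
rewrite !pow_n_Cpow, Cmult_conj, Cpow_conj.
replace (Cconj (- Cconj (z - s0))) with (- 1 * (z - s0))%C.
2: { unfold Cconj, Cminus, Cplus, Copp, Cmult, RtoC; simpl; f_equal; ring. }
rewrite Cpow_mult_l; ring.
Qed.

Lemma critical_point (t : R) : (/ 2 + Ci * t)%C = ((/ 2)%R, t).
Proof.
rewrite <- RtoC_inv by lra. unfold Cplus, Cmult, Ci, RtoC; simpl; f_equal; ring.
Qed.

Lemma critical_reflect (t : R) : (1 - Cconj ((/ 2)%R, t))%C = ((/ 2)%R, t).
Proof. unfold Cconj, Cminus, Cplus, Copp, RtoC; simpl; f_equal; field. Qed.

(** An accumulation of zeros would make the defect vanish near a point [1/2 + i p] with
    [p <> 0]; the segment from there to any real [s > 1] meets the real axis only at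
    [s], so the defect vanishes at [s] too.  Then [|zeta s| = |zeta (1 - s)|], which
    cannot hold as [s] tends to 1: zeta is bounded near 0 and unbounded near 1. *)
Lemma critical_zeros_isolated (e : C) (zeta : C -> C) (t : R) :
  is_riemann_zeta zeta -> Cmod e = 1 ->
  exists d, 0 < d /\ forall t', 0 < Rabs (t' - t) < d ->
    reflection_defect e zeta ((/ 2)%R, t') <> 0%C.
Proof.
intros Hz he; apply NNPP; intros N.
destruct Hz as [Ha Hd].
assert (Hl : locally_zero (reflection_defect e zeta) ((/ 2)%R, t)).
{ apply analytic_isolated_zeros.
  - apply reflection_defect_analytic; [easy| |]; intros E; apply (f_equal fst) in E; simpl in E;
      lra.
  - intros d hd; apply NNPP; intros N'; apply N; exists d; split; [easy|].
    intros t' ht' E; apply N'; exists ((/ 2)%R, t'); split; [|easy].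
    replace (((/ 2)%R, t') - ((/ 2)%R, t))%C with (RtoC (t' - t) * Ci)%C.
    + now rewrite Cmod_mult, Cmod_R, Cmod_Ci, Rmult_1_r.
    + unfold Cminus, Cplus, Copp, Cmult, Ci, RtoC; simpl; f_equal; ring. }
destruct (locally_zero_near _ _ Hl) as [r [hr Hr]].
assert (Hp : exists p, p <> 0 /\ locally_zero (reflection_defect e zeta) ((/ 2)%R, p)).
(* At [t = 0] the segment to [s] would run through 1. *)
{ destruct (Req_dec t 0) as [->|n]; [|now exists t].
  exists (r / 2); split; [lra|]. apply Hr.
  replace (((/ 2)%R, (r / 2)%R) - ((/ 2)%R, 0%R))%C with (RtoC (r / 2) * Ci)%C.
  - rewrite Cmod_mult, Cmod_R, Cmod_Ci, Rabs_pos_eq; lra.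
  - unfold Cminus, Cplus, Copp, Cmult, Ci, RtoC; simpl; f_equal; ring. }
destruct Hp as [p [hp Hlp]].
assert (Hs : forall s, 1 < s -> reflection_defect e zeta (RtoC s) = 0%C).
{ intros s hs; apply identity_along_segment with ((/ 2)%R, p); [|intros u hu|easy].
  - intros E; apply (f_equal snd) in E; simpl in E; lra.
  - assert (E : (((/ 2)%R, p) + RtoC u * (RtoC s - ((/ 2)%R, p)))%C = ((/ 2 + u * (s - / 2))%R,
      (p * (1 - u))%R)).
    { unfold Cminus, Cplus, Copp, Cmult, RtoC; simpl; f_equal; ring. }
    rewrite E; apply reflection_defect_analytic; [easy| |]; intros E';
      generalize (f_equal fst E') (f_equal snd E'); simpl; intros E1 E2;
      assert (u = 1) by nra; nra. }
destruct (analytic_locally_bounded zeta 0%C) as [d [B [hd HB]]].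
{ apply Ha; intros E; apply RtoC_inj in E; lra. }
destruct (zeta_unbounded_at_1 zeta B d (conj Ha Hd) hd) as [s [hs1 hs2]].
specialize (Hs s (proj1 hs1)); unfold reflection_defect in Hs.
assert (E : Cmod (zeta (RtoC s)) = Cmod (zeta (RtoC (1 - s)))).
{ assert (E1 : (e * zeta (RtoC s))%C = Cconj (e * zeta (1 - Cconj (RtoC s)))%C).
  { set (x := (e * zeta (RtoC s))%C) in *. set (y := Cconj _) in *.
    replace x with ((x - y) + y)%C by ring. rewrite Hs; ring. }
  apply (f_equal Cmod) in E1.
  rewrite Cmod_conj, !Cmod_mult, he, !Rmult_1_l in E1. rewrite E1.
  do 2 f_equal. unfold Cconj, Cminus, Cplus, Copp, RtoC; simpl; f_equal; ring. }
assert (Cmod (zeta (RtoC (1 - s))) <= B); [|lra].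
apply HB. replace (RtoC (1 - s) - 0)%C with (RtoC (1 - s)) by ring.
rewrite Cmod_R, Rabs_left; lra.
Qed.

(** A real [t] is coded by a denominator [n + 1], fine enough for [P] to fail at all other
    points within [2 / (n + 1)] of [t], and an integer [k] with [k / (n + 1)] within
    [1 / (n + 1)] of [t]. *)
Lemma isolated_reals_countable (P : R -> Prop) :
  (forall t, exists d, 0 < d /\ forall t', 0 < Rabs (t' - t) < d -> ~ P t') ->
  exists g : R -> nat, forall t t', P t -> P t' -> g t = g t' -> t = t'.
Proof.
intros H.
assert (Hg : forall t, exists c, exists (k : Z) (n : nat),
  c = Cantor.to_nat (n, Cantor.to_nat (Z.to_nat k, Z.to_nat (- k))) /\
  Rabs (t - IZR k / INR (S n)) <= / INR (S n) /\
  forall t', 0 < Rabs (t' - t) <= 2 / INR (S n) -> ~ P t').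
{ intros t; destruct (H t) as [d [hd Hd]].
  destruct (nfloor_ex (2 / d)) as [n Hn]; [apply Rdiv_le_0_compat; lra|].
  assert (hn : 0 < INR (S n)) by (apply lt_0_INR; lia).
  exists (Cantor.to_nat (n, Cantor.to_nat (Z.to_nat (up (t * INR (S n))),
    Z.to_nat (- up (t * INR (S n)))))).
  exists (up (t * INR (S n))), n; split; [easy|split].
  + destruct (archimed (t * INR (S n))) as [A1 A2].
    set (k := IZR (up (t * INR (S n)))) in *.
    replace (t - k / INR (S n)) with ((t * INR (S n) - k) * / INR (S n)) by (field;
      now apply Rgt_not_eq).
    rewrite Rabs_mult, (Rabs_pos_eq (/ _)) by (left; now apply Rinv_0_lt_compat).
    rewrite <- (Rmult_1_l (/ INR (S n))) at 2.
    apply Rmult_le_compat_r; [left; now apply Rinv_0_lt_compat|]. apply Rabs_le; lra.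
  + intros t' [h1 h2]; apply Hd; split; [easy|].
    apply Rle_lt_trans with (1 := h2).
    apply (Rmult_lt_reg_r (INR (S n))); [easy|].
    replace (2 / INR (S n) * INR (S n)) with 2 by (field; lra).
    replace 2 with (d * (2 / d)) by (field; lra).
    apply Rmult_lt_compat_l; [easy|]. rewrite S_INR; lra. }
destruct (choice _ Hg) as [g G]; exists g; intros t t' Pt Pt' Ec'.
destruct (G t) as [k [n [Ec [H1 H2]]]], (G t') as [k' [n' [Ec2 [H1' H2']]]].
rewrite Ec, Ec2 in Ec'.
apply (f_equal Cantor.of_nat) in Ec'; rewrite !Cantor.cancel_of_to in Ec'.
generalize (f_equal fst Ec') (f_equal snd Ec'); cbn [fst snd]; intros E1 E2; subst n'.
apply (f_equal Cantor.of_nat) in E2; rewrite !Cantor.cancel_of_to in E2.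
generalize (f_equal fst E2) (f_equal snd E2); cbn [fst snd]; intros E3 E4.
assert (k' = k) by lia; subst k'.
destruct (Req_dec t t') as [|ne]; [easy|exfalso].
apply (H2 t'); [split; [apply Rabs_pos_lt; lra|]|easy].
replace (t' - t) with ((t' - IZR k / INR (S n)) - (t - IZR k / INR (S n))) by ring.
eapply Rle_trans; [apply Rabs_triang|]. rewrite Rabs_Ropp.
replace (2 / INR (S n)) with (/ INR (S n) + / INR (S n)) by (unfold Rdiv; ring). lra.
Qed.

Lemma line_defect (phi : R) (zeta : C -> C) (t : R) :
  line phi (zeta (/ 2 + Ci * t)%C) -> reflection_defect (cis (- phi)) zeta ((/ 2)%R, t) = 0%C.
Proof.
intros [x Hx]; unfold reflection_defect.
rewrite critical_reflect, <- critical_point, Hx.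
change (Cexp (Ci * phi)) with (cis phi).
rewrite Cmult_assoc, <- cis_plus, Rplus_opp_l, cis_0.
unfold Cconj, Cmult, Cminus, Cplus, Copp, RtoC; simpl; f_equal; ring.
Qed.

Lemma Cmod_cis (x : R) : Cmod (cis x) = 1.
Proof.
rewrite cis_eq; unfold Cmod; simpl.
replace (cos x * (cos x * 1) + sin x * (sin x * 1)) with 1; [apply sqrt_1|].
generalize (sin2_cos2 x); unfold Rsqr; lra.
Qed.

Lemma line_values_countable (phi : R) (zeta : C -> C) : is_riemann_zeta zeta ->
  countable_set (fun w => (exists t : R, w = zeta (/ 2 + Ci * t)%C) /\ line phi w).
Proof.
intros Hz.
destruct (isolated_reals_countable (fun t => reflection_defect (cis (- phi)) zeta ((/ 2)%R,
  t) = 0%C)) as [g Hg].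
{ intros t; apply critical_zeros_isolated; [easy|apply Cmod_cis]. }
assert (H : forall w : C, exists t : R,
  (exists t : R, w = zeta (/ 2 + Ci * t)%C) -> w = zeta (/ 2 + Ci * t)%C).
{ intros w; destruct (classic (exists t : R, w = zeta (/ 2 + Ci * t)%C)) as [[t Ht]|N].
  - now exists t.
  - exists 0; easy. }
destruct (choice _ H) as [tau Htau].
assert (Hline : forall w, (exists t : R, w = zeta (/ 2 + Ci * t)%C) /\ line phi w ->
  reflection_defect (cis (- phi)) zeta ((/ 2)%R, tau w) = 0%C).
{ intros w [Hw Hl]; apply line_defect; now rewrite <- (Htau w Hw). }
exists (fun w => g (tau w)); intros z w Hz' Hw E.
rewrite (Htau z (proj1 Hz')), (Htau w (proj1 Hw)).
now rewrite (Hg (tau z) (tau w) (Hline z Hz') (Hline w Hw) E).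
Qed.

Theorem theorem1 (phi : R) (hphi : (0 <= phi < PI)%R) :
  (exists N : R -> nat,
     (forall T : R, (0 < T)%R ->
        number_of_zeros
          (fun t : R => (zDelta (/ 2 + Ci * t) - Cexp (2 * Ci * phi))%C) T (N T)) /\
     (exists K : R,
        Rbar_locally p_infty (fun T : R =>
          (Rabs (INR (N T) - T / (2 * PI) * ln (T / (2 * PI * exp 1)))
             <= K * ln T)%R))) /\
  (forall zeta : C -> C, is_riemann_zeta zeta ->
     countable_set (fun w : C =>
       (exists t : R, w = zeta (/ 2 + Ci * t)%C) /\ line phi w)).
Proof.
split.
- exact (counting_asymptotic phi).
- intros zeta Hz; now apply line_values_countable.
Qed.
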